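(* Let $\tilde w=s_{\beta_1}\cdots s_{\beta_r}$ be an expression (not necessarily reduced) in simple reflections of the Weyl group of a Kac-Moody group $G$, with toric limit $Y_{\tilde w}$. Fix $1\le i\le r$, and let $L_{I_i}\subset Y_{\tilde w}$, the cone $\gamma_{P_i}$ and the coefficients $c_\rho$ be as defined in the context. Then the class of the curve $L_{I_i}$ generates a Mori ray if and only if either $|\gamma_{P_i}(1)|=0$, or $|\gamma_{P_i}(1)|=1$ and $c_\rho=1$ for the unique $\rho\in\gamma_{P_i}(1)$.
   Context: We work over $\mathbb C$. $G$ is a Kac-Moody group; the $\beta_i$ are simple roots and $\beta_{ij}:=\langle\beta_j,\check\beta_i\rangle$, with $\check\beta_i$ the coroot of $\beta_i$. The toric limit $Y_{\tilde w}$ (the special fibre of a toric degeneration of the Bott-Samelson-Demazure-Hansen variety $Z(\tilde w)$) is the smooth projective toric variety whose fan $\Sigma$ in $\mathbb R^r$ has as cones those generated by subsets of $\{e_1^{\pm},\dots,e_r^{\pm}\}$ containing no pair $\{e_i^+,e_i^-\}$, where $e_1^+,\dots,e_r^+$ is the standard basis of $\mathbb Z^r$ and $e_i^-:=-e_i^+-\sum_{j>i}\beta_{ij}e_j^+$. Primitive relation: $\gamma_{P_i}\in\Sigma$ is the cone containing $e_i^++e_i^-$ in its relative interior ($\{0\}$ if the sum is zero), $\gamma_{P_i}(1)$ is its set of rays, and $e_i^++e_i^-=\sum_{\rho\in\gamma_{P_i}(1)}c_\rho u_\rho$ uniquely with $c_\rho>0$, $u_\rho$ the primitive generator of $\rho$.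 For $1\le j\le r$ let $\tilde w_j=s_{\beta_1}\cdots s_{\beta_j}$. Projection $\mathbb Z^j\to\mathbb Z^{j-1}$ onto the first $j-1$ coordinates induces a toric $\mathbb P^1$-fibration $f_j:Y_{\tilde w_j}\to Y_{\tilde w_{j-1}}$ ($Y_{\tilde w_0}$ a point) with two disjoint toric sections: the Schubert section, with image the toric divisor of the ray generated by $e_j^+$, and the non-Schubert section, with image the toric divisor of the ray generated by $e_j^-$. The Schubert point of $Y_{\tilde w_j}$ is the torus-fixed point of the cone generated by $e_1^+,\dots,e_j^+$; the Schubert line $L_j\subset Y_{\tilde w_j}$ is the fibre of $f_j$ over the Schubert point of $Y_{\tilde w_{j-1}}$. For $I=(i_1<\dots<i_m)$ in $\{1,\dots,r\}$, $L_I\subset Y_{\tilde w}$ is the curve obtained from the Schubert line $L_{i_1}\subset Y_{\tilde w_{i_1}}$ by applying successively, for $k=i_1+1,\dots,r$, the non-Schubert section $Y_{\tilde w_{k-1}}\to Y_{\tilde w_k}$ if $k\in I$ and the Schubert section if $k\notin I$. $I_i:=\tilde I_i$ is defined as follows: put $j_1=i$ and $a_{1,j}:=\beta_{ij}$ for $j>i$. Let $j_2>j_1$ be the least integer $\leq r$ with $a_{1,j_2}>0$ (if any), and for $j>j_2$ put $a_{2,j}:=\beta_{ij_2}\beta_{j_2j}-\beta_{ij}$. For $k>2$, let $j_k>j_{k-1}$ be the least integer $\le r$ with $a_{k-1,j_k}<0$ (if any), and for $j>j_k$ put $a_{k,j}:=-a_{k-1,j_k}\beta_{j_kj}+a_{k-1,j}$.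 The process stops when no such integer exists; $\tilde I_i:=\{j_1,\dots,j_m\}$ is the set of all indices produced. The Mori cone $\overline{NE}(X)$ is the closure in $N_1(X)$ (real 1-cycles modulo numerical equivalence) of the convex cone generated by classes of irreducible curves. An extremal ray $R$ (one-dimensional face) of $\overline{NE}(X)$ is called Mori if $R\cdot K_X<0$. *)

(* Defs.v *)
From HB Require Import structures.
From mathcomp Require Import all_boot all_order all_algebra.
From mathcomp Require Import mpoly complex.
From mathcomp Require Import boolp classical_sets reals topology normedtype.

Set Implicit Arguments.
Unset Strict Implicit.
Unset Printing Implicit Defensive.

Import Order.TTheory GRing.Theory Num.Theory.
Import numFieldNormedType.Exports.
Local Open Scope classical_set_scope.
Local Open Scope ring_scope.

(******************************************************************************)
(* Toric varieties over C, in Cox's homogeneous coordinates.                  *)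
(*                                                                            *)
(* A simplicial fan in Z^n with m rays is given by the primitive generators   *)
(* u_rho (the rows of [rays]) and by the family of ray sets of its cones.     *)
(* The toric variety is X = Xhat / H, where Xhat in C^m is the complement of  *)
(* the zero locus of the irrelevant ideal and H = Hom(Cl X, C^* ).  A subset  *)
(* of X is represented by its (H-stable) preimage in Xhat, so the divisor     *)
(* D_rho is { z_rho = 0 } and the closed subsets are the zero loci of         *)
(* families of Cl X-homogeneous polynomials.                                  *)
(* A divisor \sum_rho a_rho D_rho is represented by the row vector a.         *)
(******************************************************************************)

Record fan (n m : nat) := Fan {
  rays : 'M[int]_(m, n);
  cones : {set {set 'I_m}} }.

Section Toric.
Variables (R : realType) (n m : nat) (F : fan n m).

Definition Xhat : set 'rV[R[i]]_m :=
  [set z : 'rV[R[i]]_m | [set rho | z ord0 rho == 0]%SET \in cones F].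

(* The divisor of the character chi is \sum_rho <chi, u_rho> D_rho. *)
Definition lin_equiv (D D' : 'rV[int]_m) : Prop :=
  exists chi : 'rV[int]_n, D' = D + chi *m (rays F)^T.

(* Global sections of O(D): polynomials all of whose monomials z^a satisfy    *)
(* \sum_rho a_rho D_rho ~ D.                                                  *)
Definition sections (D : 'rV[int]_m) : set {mpoly R[i][m]} :=
  [set p | forall a, a \in msupp p -> lin_equiv D (\row_rho (a rho)%:Z)].

Definition zeros (p : {mpoly R[i][m]}) : set 'rV[R[i]]_m :=
  [set z : 'rV[R[i]]_m | p.@[z ord0] = 0].

Definition zclosed (Z : set 'rV[R[i]]_m) : Prop :=
  exists S : set {mpoly R[i][m]},
    (forall p, S p -> exists D, sections D p) /\
    Z = Xhat `&` \bigcap_(p in S) zeros p.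

Definition zirreducible (Z : set 'rV[R[i]]_m) : Prop :=
  [/\ zclosed Z, Z !=set0 &
      forall Z1 Z2, zclosed Z1 -> zclosed Z2 -> Z = Z1 `|` Z2 ->
        Z = Z1 \/ Z = Z2].

(* dim Z >= d: a chain Z_0 < ... < Z_d = Z of irreducible closed subsets. *)
Definition dim_ge (Z : set 'rV[R[i]]_m) (d : nat) : Prop :=
  exists c : nat -> set 'rV[R[i]]_m,
    [/\ c d = Z, forall k, (k <= d)%N -> zirreducible (c k) &
        forall k, (k < d)%N -> c k `<` c k.+1].

Definition irreducible_curve (Z : set 'rV[R[i]]_m) : Prop :=
  [/\ zirreducible Z, dim_ge Z 1 & ~ dim_ge Z 2].

(* d is the dimension of the degree D part of the homogeneous coordinate ring *)
(* of Z, i.e. of the image of H^0(X, O(D)) in H^0(Z, O(D)|_Z).                *)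
Definition is_coord_dim (Z : set 'rV[R[i]]_m) (D : 'rV[int]_m) (d : nat) :
    Prop :=
  exists s : 'I_d -> {mpoly R[i][m]},
    [/\ forall k, sections D (s k),
        forall a : 'I_d -> R[i], Z `<=` zeros (\sum_k a k *: s k) ->
          forall k, a k = 0 &
        forall p, sections D p ->
          exists a : 'I_d -> R[i], Z `<=` zeros (p - \sum_k a k *: s k)].

Definition coord_dim (Z : set 'rV[R[i]]_m) (D : 'rV[int]_m) : nat :=
  xget 0%N [set d | is_coord_dim Z D d].

Definition globally_generated (D : 'rV[int]_m) : Prop :=
  forall z, Xhat z -> exists2 p, sections D p & p.@[z ord0] != 0.

(* The intersection number of a divisor D with a curve Z (X smooth            *)
(* projective):                                                               *)
(*     D . Z = chi(Z, O(A + D)|_Z) - chi(Z, O(A)|_Z)     for every A.         *)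
(* For A = A0 + N with A0 sufficiently ample and N globally generated, both   *)
(* Euler characteristics are values of [coord_dim Z] (Fujita vanishing for    *)
(* the ideal sheaf and the structure sheaf of Z).                             *)
Definition is_intersection_number (D : 'rV[int]_m) (Z : set 'rV[R[i]]_m)
    (d : int) : Prop :=
  exists A0 : 'rV[int]_m, forall N, globally_generated N ->
    d = (coord_dim Z (A0 + N + D))%:Z - (coord_dim Z (A0 + N))%:Z.

Definition intersection_number (D : 'rV[int]_m) (Z : set 'rV[R[i]]_m) : int :=
  xget 0 [set d | is_intersection_number D Z d].

(* N_1(X) is embedded in R^m by v |-> (D_rho . v)_rho: the D_rho generate     *)
(* Pic X for X smooth, so two 1-cycles are numerically equivalent iff they    *)
(* have the same image.                                                       *)
Definition curve_class (Z : set 'rV[R[i]]_m) : 'rV[R]_m :=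
  \row_rho (intersection_number (delta_mx ord0 rho) Z)%:~R.

Definition dot1 (D : 'rV[int]_m) (v : 'rV[R]_m) : R :=
  \sum_rho (D ord0 rho)%:~R * v ord0 rho.

(* Divisor of the rational form dlog t_1 /\ ... /\ dlog t_n, which is         *)
(* +/- \prod_(rho in sigma) (d z_rho / z_rho) in the chart of a smooth        *)
(* maximal cone sigma.                                                        *)
Definition canonical_divisor : 'rV[int]_m := const_mx (-1).

End Toric.

Section Cones.
Variables (R : realType) (m : nat).

Definition convex_cone (S : set 'rV[R]_m) : set 'rV[R]_m :=
  [set v | exists (k : nat) (a : 'I_k -> R) (s : 'I_k -> 'rV[R]_m),
    [/\ forall l, 0 <= a l, forall l, S (s l) & v = \sum_l a l *: s l]].

Definition half_line (v : 'rV[R]_m) : set 'rV[R]_m :=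
  [set x | exists2 t : R, 0 <= t & x = t *: v].

Definition extremal_ray (K Q : set 'rV[R]_m) : Prop :=
  [/\ exists2 v, v != 0 & Q = half_line v,
      Q `<=` K &
      forall x y, K x -> K y -> Q (x + y) -> Q x /\ Q y].

End Cones.

Definition mori_cone (R : realType) n m (F : fan n m) : set 'rV[R]_m :=
  closure (convex_cone
    [set v | exists2 Z, irreducible_curve F Z & v = curve_class F Z]).

Definition mori_ray (R : realType) n m (F : fan n m) (Q : set 'rV[R]_m) :
    Prop :=
  extremal_ray (mori_cone F) Q /\
  forall x, Q x -> x != 0 -> dot1 (canonical_divisor m) x < 0.

(******************************************************************************)
(* Kac-Moody data and toric limits.  Positions in words are counted from 0.   *)
(******************************************************************************)

Definition gcm (T : finType) (A : T -> T -> int) : Prop :=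
  [/\ forall s, A s s = 2,
      forall s t, s != t -> A s t <= 0 &
      forall s t, A s t = 0 -> A t s = 0].

Definition pairing n (x y : 'rV[int]_n) : int := (x *m y^T) ord0 ord0.

(* Tits' root datum of a Kac-Moody group: simple roots in the character       *)
(* lattice and simple coroots in the dual lattice.                            *)
Record kac_moody := KacMoody {
  simple : finType;
  km_rank : nat;
  root : simple -> 'rV[int]_km_rank;
  coroot : simple -> 'rV[int]_km_rank;
  km_gcm : gcm (fun s t => pairing (root t) (coroot s)) }.

Section ToricLimit.
Variables (R : realType) (G : kac_moody) (w : seq (simple G)).

(* beta_ij = < beta_j, coroot of beta_i >; the value 0 outside the word is    *)
(* junk.                                                                      *)
Definition beta (i j : nat) : int :=
  if (onth w i, onth w j) is (Some s, Some t)
  then pairing (root t) (coroot s) else 0.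

(* Indices of the rays of the fan in Z^k, and of the Cox coordinates. *)
Definition plus k (i : 'I_k) : 'I_(k + k) := lshift k i.
Definition minus k (i : 'I_k) : 'I_(k + k) := rshift k i.

(* Y_{w_k}, for the prefix w_k of length k of w. *)
Definition toric_limit (k : nat) : fan k (k + k) :=
  Fan (col_mx 1%:M
        (\matrix_(i, j) (- (i == j)%:R - (i < j)%N%:R * beta i j)))
      [set sigma : {set 'I_(k + k)} |
        [forall i : 'I_k, ~~ ((plus i \in sigma) && (minus i \in sigma))]]%SET.

(* f_{k+1} : Y_{w_{k+1}} -> Y_{w_k} forgets the last pair of coordinates. *)
Definition proj k (z : 'rV[R[i]]_(k.+1 + k.+1)) : 'rV[R[i]]_(k + k) :=
  row_mx (\row_(i < k) z ord0 (plus (widen_ord (leqnSn k) i)))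
         (\row_(i < k) z ord0 (minus (widen_ord (leqnSn k) i))).

Definition toric_divisor k (rho : 'I_(k + k)) : set 'rV[R[i]]_(k + k) :=
  Xhat (toric_limit k) `&` [set z : 'rV[R[i]]_(k + k) | z ord0 rho = 0].

Definition schubert_point k : set 'rV[R[i]]_(k + k) :=
  Xhat (toric_limit k) `&`
  [set z : 'rV[R[i]]_(k + k) | forall i : 'I_k, z ord0 (plus i) = 0].

Definition schubert_line k : set 'rV[R[i]]_(k.+1 + k.+1) :=
  Xhat (toric_limit k.+1) `&` @proj k @^-1` @schubert_point k.

(* Image of a subset Z of Y_{w_k} under the Schubert ([b = false]), resp.     *)
(* non-Schubert ([b = true]), section of f_{k+1}: the part over Z of the      *)
(* image of the section.                                                      *)
Definition section_image (b : bool) k (Z : set 'rV[R[i]]_(k + k)) :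
    set 'rV[R[i]]_(k.+1 + k.+1) :=
  toric_divisor (if b then minus (@ord_max k) else plus (@ord_max k))
  `&` @proj k @^-1` Z.

(* Image in Y_{w_k} of the Schubert line of Y_{w_{i+1}}, for i < k; the value *)
(* for k <= i is junk.                                                        *)
Fixpoint lift_line (i : nat) (I : seq nat) (k : nat) : set 'rV[R[i]]_(k + k) :=
  match k with
  | 0 => set0
  | k'.+1 => if k' == i then @schubert_line k'
             else section_image (k' \in I) (@lift_line i I k')
  end.

(* I is a nonempty increasing sequence of positions. *)
Definition line (I : seq nat) : set 'rV[R[i]]_(size w + size w) :=
  @lift_line (head 0%N I) I (size w).

(* Positions p such that j < p < size w, in increasing order. *)
Definition positions_after (j : nat) : seq nat := iota j.+1 (size w - j.+1).

(* j is j_k and a is a_k; returns j_{k+1}, j_{k+2}, ...  The fuel size w is   *)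
(* enough, since the j_k increase.                                            *)
Fixpoint index_steps (fuel j : nat) (a : nat -> int) : seq nat :=
  if fuel is fuel'.+1 then
    if [seq l <- positions_after j | a l < 0] is j' :: _ then
      j' :: index_steps fuel' j' (fun l => - a j' * beta j' l + a l)
    else [::]
  else [::].

Definition index_set (i : nat) : seq nat :=
  i :: (if [seq l <- positions_after i | 0 < beta i l] is j2 :: _ then
          j2 :: index_steps (size w) j2
                  (fun l => beta i j2 * beta j2 l - beta i l)
        else [::]).

(* gamma is the cone having e_i^+ + e_i^- in its relative interior, and       *)
(* e_i^+ + e_i^- = \sum_(rho in gamma) c_rho u_rho.                           *)
Definition primitive_relation (i : 'I_(size w))
    (gamma : {set 'I_(size w + size w)}) (c : 'I_(size w + size w) -> R) :
    Prop :=
  let u rho : 'rV[R]_(size w) :=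
    map_mx intr (row rho (rays (toric_limit (size w)))) in
  [/\ gamma \in cones (toric_limit (size w)),
      forall rho, rho \in gamma -> 0 < c rho &
      u (plus i) + u (minus i) = \sum_(rho in gamma) c rho *: u rho].

End ToricLimit.

Arguments schubert_point R {G} w k _ : rename.
Arguments schubert_line R {G} w k _ : rename.
Arguments lift_line R {G} w i I k _ : rename.
Arguments line R {G} w I _ : rename.

(* Main.v *)
(* Put gamma = gamma_{P_i}.  The index set I_i consists of i and of the positions
   at which the expansion of e_i^+ + e_i^- uses a ray e_j^-, so L_{I_i} is the
   curve {z_rho = 0, rho in tau} for a wall tau containing gamma, and its class
   is the primitive relation of i: D_rho . L = 1 for rho = e_i^+, e_i^-, and
   D_rho . L = - c_rho for rho in gamma.  Hence - K . L = 2 - \sum c_rho, with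
   the c_rho positive integers, and it remains to see that every L_{I_i} spans
   an extremal ray.

   The r primitive relations give a basis of N_1, and the dual basis of Pic
   consists of globally generated divisors N_1, ..., N_r.  So it suffices to show
   that the class of an arbitrary irreducible curve Z is a combination of
   primitive relations with coefficients N_j . Z >= 0.  Let R be the homogeneous
   coordinate ring of Z, s in R_{N_j} nonzero and t in R_{N_k} without common
   zero with s (the zeros of s on Z are finitely many points).  By the
   Nullstellensatz R_n = s R_{n - N_j} + t R_{n - N_k} for n large, so
     dim R_{n + N_j + N_k} + dim R_n <= dim R_{n + N_j} + dim R_{n + N_k}:
   the increments dim R_{n + N_j} - dim R_n are nonnegative and eventually
   nonincreasing in every direction, hence eventually constant, equal to
   N_j . Z.  The Nullstellensatz is proved from the uncountability of C, the
   finiteness of the zeros of s from Hilbert's basis theorem. *)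

Require Import Defs.
From mathcomp Require Import all_boot all_order all_algebra.
From mathcomp Require Import mpoly complex.
From mathcomp Require Import boolp classical_sets reals topology normedtype.
From mathcomp Require Import ring lra zify.

Set Implicit Arguments.
Unset Strict Implicit.
Unset Printing Implicit Defensive.

Import Order.TTheory GRing.Theory Num.Theory.
Import numFieldNormedType.Exports.
Local Open Scope classical_set_scope.
Local Open Scope ring_scope.

(** * Dimensions modulo a subspace *)

Section FreeModulo.
Variables (K : fieldType) (E : lmodType K) (I V : E -> Prop).

Definition submodule (J : E -> Prop) :=
  J 0 /\ forall a p q, J p -> J q -> J (a *: p + q).

Definition free_mod d (s : nat -> E) := forall a : nat -> K,
  I (\sum_(k < d) a k *: s k) -> forall k, (k < d)%N -> a k = 0.

Definition gen_mod d (s : nat -> E) := forall p, V p ->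
  exists a : nat -> K, I (p - \sum_(k < d) a k *: s k).

Definition is_dim d := exists s, [/\ forall k, (k < d)%N -> V (s k),
  free_mod d s & gen_mod d s].

Lemma submodule0 J : submodule J -> J 0. Proof. by case. Qed.

Lemma submoduleD J p q : submodule J -> J p -> J q -> J (p + q).
Proof. by case=> _ h Jp Jq; rewrite -[p]scale1r; apply: h. Qed.

Lemma submoduleZ J a p : submodule J -> J p -> J (a *: p).
Proof. by case=> h0 h Jp; rewrite -[_ *: _]addr0; apply: h. Qed.

Lemma submodule_sum J T (r : seq T) (P : pred T) F : submodule J ->
  (forall i, P i -> J (F i)) -> J (\sum_(i <- r | P i) F i).
Proof.
move=> h hF; elim/big_ind: _ => //; first exact: submodule0.
by move=> x y; apply: submoduleD.
Qed.

Hypothesis subI : submodule I.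

(** Expanding [t] in [s] modulo [I] gives a [d] by [n] matrix; if [n < d], a nonzero vector of its
    left kernel is a relation between the [t k] modulo [I]. *)
Lemma free_gen_leq d n s t : gen_mod n s ->
  (forall k, (k < d)%N -> V (t k)) -> free_mod d t -> (d <= n)%N.
Proof.
move=> gs Vt ft; rewrite leqNgt; apply/negP => ltnd.
have /choice[A hA] (k : 'I_d) : exists a : nat -> K,
  I (t k - \sum_(l < n) a l *: s l) by apply/gs/Vt.
pose M : 'M[K]_(d, n) := \matrix_(k, l) A k l.
have /rowV0Pn[v /sub_kermxP vM v0] : kermx M != 0.
  by rewrite kermx_eq0 /row_free neq_ltn (leq_ltn_trans (rank_leq_col M)).
pose a (k : nat) : K := if insub k is Some k' then v ord0 k' else 0.
have aE (k : 'I_d) : a k = v ord0 k by rewrite /a valK.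
move: v0; apply/negP; rewrite negbK; apply/eqP/rowP => k.
rewrite mxE -aE; apply: ft (ltn_ord k).
have -> : \sum_(k < d) a k *: t k =
  \sum_(k < d) a k *: (t k - \sum_(l < n) A k l *: s l).
  rewrite -[LHS]subr0; under [RHS]eq_bigr do rewrite scalerBr.
  rewrite sumrB; congr (_ - _).
  under eq_bigr do rewrite scaler_sumr.
  rewrite exchange_big /= big1 // => l _.
  under eq_bigr do rewrite scalerA.
  rewrite -scaler_suml; move/rowP/(_ l): vM; rewrite !mxE => h.
  by under eq_bigr => i _ do [rewrite aE -[A i l](mxE matrix_key (fun i l => A i l))];
  rewrite h scale0r.
by apply: submodule_sum => // i _; apply: submoduleZ.
Qed.

(** A family that does not generate is lengthened by an element outside its span; [B] bounds the
    number of times. *)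
Lemma free_extend B d s :
  (forall d s, (forall k, (k < d)%N -> V (s k)) -> free_mod d s -> (d <= B)%N) ->
  (forall k, (k < d)%N -> V (s k)) -> free_mod d s ->
  exists d' s', [/\ (d <= d')%N, forall k, (k < d)%N -> s' k = s k,
    forall k, (k < d')%N -> V (s' k), free_mod d' s' & gen_mod d' s'].
Proof.
move=> hB; have [n] := ubnP (B - d); elim: n d s => // n IH d s ltn Vs fs.
have [gs|/existsNP[p /not_implyP[Vp /forallNP np]]] := pselect (gen_mod d s).
  by exists d, s.
pose s1 k := if (k < d)%N then s k else p.
have s1E (a : nat -> K) : \sum_(k < d.+1) a k *: s1 k = \sum_(k < d) a k *: s k + a d *: p.
  rewrite big_ord_recr /= /s1 ltnn; congr (_ + _).
  by apply: eq_bigr => k _; rewrite ltn_ord.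
have Vs1 k : (k < d.+1)%N -> V (s1 k).
  by rewrite /s1 ltnS; case: (ltnP k d) => // h _; apply: Vs.
have fs1 : free_mod d.+1 s1.
  move=> a; rewrite s1E => Ia.
  have ad : a d = 0.
    apply: contrapT => /eqP ad; apply: (np (fun k => - (a d)^-1 * a k)).
    under eq_bigr do rewrite -scalerA.
    rewrite -scaler_sumr scaleNr opprK addrC.
    by rewrite -[p in _ + p](scalerK ad) -scalerDr; apply: submoduleZ.
  move: Ia; rewrite ad scale0r addr0 => /fs ak k.
  by rewrite ltnS leq_eqVlt => /orP[/eqP->//|/ak].
have := hB _ _ Vs1 fs1 => ltdB.
have [|d' [s' [h1 h2 h3 h4 h5]]] := IH d.+1 s1 _ Vs1 fs1.
  by move: ltn ltdB; lia.
exists d', s'; split => //; first exact: ltnW.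
by move=> k kd; rewrite h2 /s1 ?kd // ltnW.
Qed.

Lemma ex_dim B :
  (forall d s, (forall k, (k < d)%N -> V (s k)) -> free_mod d s -> (d <= B)%N) ->
  exists d, is_dim d.
Proof.
move=> hB; have [//|//|d' [s' [_ _ h3 h4 h5]]] := @free_extend B 0 (fun=> 0) hB.
by exists d', s'.
Qed.

Lemma is_dim_uniq d d' : is_dim d -> is_dim d' -> d = d'.
Proof.
move=> [s [Vs fs gs]] [s' [Vs' fs' gs']]; apply/eqP.
by rewrite eqn_leq (free_gen_leq gs' Vs fs) (free_gen_leq gs Vs' fs').
Qed.

End FreeModulo.

(** * Dickson's lemma and Hilbert's basis theorem *)

(** Induction on [n]. If [M] bounds the last coordinate on a basis [B] for the first [n]
    coordinates, [B] serves every [a] with [a n >= M]; each of the finitely many slices below [M]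
    has its own basis by induction. *)
Lemma dickson n (P : (nat -> nat) -> Prop) : exists B : seq (nat -> nat),
  (forall b, List.In b B -> P b) /\
  forall a, P a -> exists2 b, List.In b B & forall i, (i < n)%N -> (b i <= a i)%N.
Proof.
elim: n P => [|n IH] P.
  have [[a Pa]|nP] := pselect (exists a, P a).
    exists [:: a]; split; first by move=> b [<-|].
    by move=> b _; exists a => //; left.
  by exists [::]; split=> // a Pa; case: nP; exists a.
have [B [BP hB]] := IH P.
have [M hM] : exists M, forall b, List.In b B -> (b n <= M)%N.
  elim: B {BP hB} => [|b B [M hM]]; first by exists 0%N.
  exists (maxn (b n) M) => c [<-|/hM cM]; first exact: leq_maxl.
  exact: leq_trans cM (leq_maxr _ _).
have [C [CP hC]] : exists C : seq (nat -> nat), (forall b, List.In b C -> P b) /\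
  forall a, P a -> (a n < M)%N -> exists2 b, List.In b C &
    forall i, (i < n.+1)%N -> (b i <= a i)%N.
  elim: M {hM} => [|M [C [CP hC]]]; first by exists [::]; split.
  have [D [DP hD]] := IH (fun a => P a /\ a n = M).
  exists (C ++ D); split=> [b /List.in_app_iff[/CP|/DP[]]//|a Pa].
  rewrite ltnS leq_eqVlt => /orP[/eqP aM|/(hC _ Pa)[b bC hb]]; last first.
    by exists b => //; apply/List.in_app_iff; left.
  have [b bD hb] := hD _ (conj Pa aM).
  exists b; first by apply/List.in_app_iff; right.
  move=> i; rewrite ltnS leq_eqVlt => /orP[/eqP->|/hb//].
  by rewrite aM (DP _ bD).2.
exists (B ++ C); split=> [b /List.in_app_iff[/BP|/CP]//|a Pa].
have [aM|aM] := ltnP (a n) M.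
  have [b bC hb] := hC _ Pa aM.
  by exists b => //; apply/List.in_app_iff; right.
have [b bB hb] := hB _ Pa.
exists b; first by apply/List.in_app_iff; left.
move=> i; rewrite ltnS leq_eqVlt => /orP[/eqP->|/hb//].
exact: leq_trans (hM _ bB) aM.
Qed.

Section HilbertBasis.
Variables (K : fieldType) (n : nat) (f : nat -> {mpoly K[n]}).

Definition seq_ideal k q :=
  exists g : nat -> {mpoly K[n]}, q = \sum_(i < k) g i * f i.

Lemma seq_ideal_mono k k' q : (k <= k')%N -> seq_ideal k q -> seq_ideal k' q.
Proof.
move=> kk' [g ->]; exists (fun i => if (i < k)%N then g i else 0).
rewrite (big_ord_widen _ (fun i => g i * f i) kk') big_mkcond /=.
by apply: eq_bigr => i _; case: ifP => // _; rewrite mul0r.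
Qed.

Lemma seq_idealD k p q : seq_ideal k p -> seq_ideal k q -> seq_ideal k (p + q).
Proof.
move=> [g ->] [g' ->]; exists (fun i => g i + g' i).
by rewrite -big_split /=; apply: eq_bigr => i _; rewrite mulrDl.
Qed.

Lemma seq_idealM k p q : seq_ideal k q -> seq_ideal k (p * q).
Proof.
move=> [g ->]; exists (fun i => p * g i).
by rewrite mulr_sumr; apply: eq_bigr => i _; rewrite mulrA.
Qed.

Lemma mlead_reduce (p q : {mpoly K[n]}) : p != 0 -> q != 0 ->
  (mlead q <= mlead p)%MM ->
  let r := p - (mleadc p / mleadc q) *: 'X_[mlead p - mlead q] * q in
  r = 0 \/ (mlead r < mlead p)%O.
Proof.
move=> p0 q0 le /=; set u := _ *: _; set r := p - _.
have [->|r0] := eqVneq r 0; [by left|right].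
have c0 : mleadc p / mleadc q != 0 by rewrite mulf_neq0 ?invr_eq0 ?mleadc_eq0.
have u0 : u != 0 by rewrite -mleadc_eq0 mleadcZE mleadXm mcoeffX eqxx mulr1.
have lu : mlead (u * q) = mlead p by rewrite mleadM // mleadZ // mleadXm submK.
have lr : (mlead r <= mlead p)%O.
  by have := mleadB_le p (u * q); rewrite lu joinxx.
rewrite lt_neqAle lr andbT; apply/eqP => e.
have uq : (u * q)@_(mlead p) = mleadc p.
  have := mleadcM u q; rewrite -mleadM // lu => ->.
  rewrite mleadcZE mleadXm mcoeffX eqxx mulr1.
  by apply: divfK; rewrite mleadc_eq0.
by move: r0; rewrite -mleadc_eq0 e /r mcoeffB uq subrr eqxx.
Qed.

(** By Dickson's lemma the leading exponents of the ideal of all the [f k] dominate finitely many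
    ones, already attained in the ideal of the first [N] terms; division by leading terms then puts
    [f N] in that ideal. *)
Lemma hilbert_basis_seq : exists k, seq_ideal k (f k).
Proof.
pose I q := exists k, seq_ideal k q.
pose P (a : nat -> nat) := exists q, [/\ I q, q != 0 &
  forall i : 'I_n, mlead q i = a i].
have [B [BP hB]] := dickson n P.
have [N hN] : exists N, forall b, List.In b B -> exists q,
    [/\ seq_ideal N q, q != 0 & forall i : 'I_n, mlead q i = b i].
  elim: B {hB} BP => [|b B IH] BP; first by exists 0%N.
  have [|N hN] := IH; first by move=> c cB; apply: BP; right.
  have [q [[k qk] q0 qb]] := BP b (or_introl erefl).
  exists (maxn k N) => c [<-|/hN[q' [h1 h2 h3]]].
    by exists q; split=> //; apply: seq_ideal_mono qk; apply: leq_maxl.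
  by exists q'; split=> //; apply: seq_ideal_mono h1; apply: leq_maxr.
exists N.
have : I (f N).
  exists N.+1, (fun i => (i == N)%:R); rewrite big_ord_recr /= eqxx mul1r.
  by rewrite big1 ?add0r // => i _; rewrite (ltn_eqF (ltn_ord i)) mul0r.
elim/mleadrect: (f N) => p IH Ip.
have [->|p0] := eqVneq p 0.
  by exists (fun=> 0); rewrite big1 // => i _; rewrite mul0r.
pose a i := if insub i is Some j then mlead p (j : 'I_n) else 0%N.
have [|b bB hb] := hB a.
  by exists p; split=> // i; rewrite /a valK.
have [q [qN q0 qb]] := hN _ bB.
have le : (mlead q <= mlead p)%MM.
  by apply/mnm_lepP => i; rewrite qb; have := hb i (ltn_ord i); rewrite /a valK.
have := mlead_reduce p0 q0 le; set u := _ *: _; set r := p - _ => /= hr.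
have -> : p = r + u * q by rewrite subrK.
apply: seq_idealD; last exact: seq_idealM.
case: hr => [->|lr].
  by exists (fun=> 0); rewrite big1 // => i _; rewrite mul0r.
apply: IH => //; case: Ip => k pk; exists (maxn k N).
apply: seq_idealD; first exact: seq_ideal_mono (leq_maxl _ _) pk.
rewrite -mulNr; apply: seq_idealM.
exact: seq_ideal_mono (leq_maxr _ _) qN.
Qed.

End HilbertBasis.

(** * The Nullstellensatz over C *)

(** One point is avoided at a time, by the right half or the left quarter, according to whether it
    is at most one third of the way or beyond. *)
Lemma subinterval_avoiding (R : realFieldType) (s : seq R) (a b : R) : a < b ->
  exists a' b', [/\ a <= a', a' < b', b' <= b & forall x, x \in s ->
    ~~ (a' <= x <= b')].
Proof.
move=> ab; elim: s => [|x s [a' [b' [h1 h2 h3 h4]]]]; first by exists a, b.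
have [hx|hx] := leP x (a' + (b' - a') / 3).
  exists (a' + (b' - a') / 2), b'; split=> //; try by lra.
  move=> y; rewrite inE => /orP[/eqP->|/h4]; first by apply/negP; lra.
  by apply: contra; lra.
exists a', (a' + (b' - a') / 4); split=> //; try by lra.
move=> y; rewrite inE => /orP[/eqP->|/h4]; first by apply/negP; lra.
by apply: contra; lra.
Qed.

(** Cantor's nested intervals, each step avoiding one more list; the supremum of the left endpoints
    lies in all of them. *)
Lemma real_uncountable (R : realType) (s : nat -> seq R) :
  exists x, forall n, x \notin s n.
Proof.
have /choice[f hf] (n_ab : nat * {ab : R * R | ab.1 < ab.2}) :
    exists ab' : {ab : R * R | ab.1 < ab.2},
    [/\ (sval n_ab.2).1 <= (sval ab').1, (sval ab').2 <= (sval n_ab.2).2 &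
     forall x, x \in s n_ab.1 -> ~~ ((sval ab').1 <= x <= (sval ab').2)].
  case: n_ab => n [[a b] /= ab].
  have [a' [b' [h1 h2 h3 h4]]] := subinterval_avoiding (s n) ab.
  by exists (exist (fun ab : R * R => ab.1 < ab.2) (a', b') h2).
pose g := nat_rect (fun=> {ab : R * R | ab.1 < ab.2})
  (exist (fun ab : R * R => ab.1 < ab.2) (0, 1) ltr01) (fun n ab => f (n, ab)).
pose a n := (sval (g n)).1; pose b n := (sval (g n)).2.
have ab n : a n < b n by apply: (svalP (g n)).
have aS n : a n <= a n.+1 by have [] := hf (n, g n).
have bS n : b n.+1 <= b n by have [] := hf (n, g n).
have am m n : (m <= n)%N -> a m <= a n.
  by elim: n => [|n IH]; [case: m|rewrite leq_eqVlt => /orP[/eqP->//|/IH/le_trans]; apply].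
have bm m n : (m <= n)%N -> b n <= b m.
  elim: n => [|n IH]; [by case: m|rewrite leq_eqVlt => /orP[/eqP->//|/IH]].
  exact: le_trans (bS n).
have amb m n : a m <= b n.
  have [mn|/ltnW nm] := leqP m n.
    exact: le_trans (am _ _ mn) (ltW (ab n)).
  exact: le_trans (ltW (ab m)) (bm _ _ nm).
pose A : set R := [set x | exists n, x = a n].
have A0 : has_sup A.
  split; first by exists (a 0%N), 0%N.
  by exists (b 0%N) => _ [n ->].
exists (sup A) => n; apply/negP => xs.
have [_ _ /(_ _ xs)/negP] := hf (n, g n); apply; apply/andP; split.
  by apply: ub_le_sup; [exact: A0.2|exists n.+1].
by apply: ge_sup; [exact: A0.1|move=> _ [m ->]; apply: (amb m n.+1)].
Qed.

Section Nullstellensatz.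
Variables (R : realType) (m : nat).
Local Notation K := R[i].
Local Notation S := {mpoly K[m]}.
Implicit Types (J M : set S) (p q f g b : S).

Definition ideal J :=
  [/\ J 0, forall p q, J p -> J q -> J (p + q) & forall f p, J p -> J (f * p)].

Lemma idealN J p : ideal J -> J p -> J (- p).
Proof. by case=> _ _ h Jp; rewrite -mulN1r; apply: h. Qed.

Lemma idealB J p q : ideal J -> J p -> J q -> J (p - q).
Proof. by move=> h Jp Jq; case: (h) => _ hD _; apply: hD => //; apply: idealN. Qed.

Lemma ideal_sum J T (r : seq T) (P : pred T) F : ideal J ->
  (forall i, P i -> J (F i)) -> J (\sum_(i <- r | P i) F i).
Proof. by case=> h0 hD _ hF; elim/big_ind: _. Qed.

Lemma ideal_bigcup_chain (F : set (set S)) : F !=set0 ->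
  (forall X, F X -> ideal X) -> total_on F subset -> ideal (\bigcup_(X in F) X).
Proof.
move=> [X0 FX0] Fi Ft; split.
- by exists X0 => //; case: (Fi _ FX0).
- move=> p q [X FX Xp] [Y FY Yq].
  have [XY|YX] := Ft _ _ FX FY.
    by exists Y => //; have [_ hD _] := Fi _ FY; apply: hD => //; apply: XY.
  by exists X => //; have [_ hD _] := Fi _ FX; apply: hD => //; apply: YX.
- by move=> f p [X FX Xp]; exists X => //; have [_ _] := Fi _ FX; apply.
Qed.

(** Zorn's lemma. [M] is the trace of a maximal ideal of the localization at [b]; an [f] outside [M]
    is a unit modulo that ideal, whence the last clause. *)
Lemma ex_maximal_avoiding J b : ideal J -> (forall k, ~ J (b ^+ k)) ->
  exists M, [/\ ideal M, J `<=` M, forall k, ~ M (b ^+ k) &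
    forall f, ~ M f -> exists k q, M (b ^+ k - q * f)].
Proof.
move=> Ji Jb.
pose good X := [/\ ideal X, J `<=` X & forall k, ~ X (b ^+ k)].
have [F FP Ft|M [PM Mmax]] := @Zorn_bigcup S (fun X => X = set0 \/ good X).
  have [Fn|F0] := pselect (exists2 X, F X & X !=set0); last first.
    left; apply/seteqP; split=> // p [X FX Xp].
    by case: F0; exists X => //; exists p.
  right; case: Fn => X0 FX0 X00.
  pose F' X := F X /\ X !=set0.
  have F'g X : F' X -> good X.
    by case=> /FP[->|//] [x []].
  have -> : \bigcup_(X in F) X = \bigcup_(X in F') X.
    apply/seteqP; split=> p [X FX Xp]; exists X => //; last by case: FX.
    by split=> //; exists p.
  split.
  - apply: ideal_bigcup_chain; first by exists X0.
      by move=> X /F'g[].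
    by move=> X Y [FX _] [FY _]; apply: Ft.
  - by move=> p Jp; exists X0; [split|have [_ + _] := F'g X0 (conj FX0 X00); apply].
  - by move=> k [X /F'g[_ _ h] /h].
have gJ : good J by split.
have [Mi JM Mb] : good M.
  case: PM => // M0; exfalso; apply: (Mmax J); last by right.
  rewrite M0; split; first by move=> p [].
  by move=> /(_ 0); apply; case: Ji.
exists M; split=> // f nMf.
pose M' : set S := [set p | exists q, M (p - q * f)].
have [M0 MD MM] := Mi.
have MM' : M `<` M'.
  split; first by move=> p Mp; exists 0; rewrite mul0r subr0.
  move=> /(_ f) h; apply: nMf; apply: h; exists 1; by rewrite mul1r subrr.
have M'i : ideal M'.
  split; first by exists 0; rewrite mul0r subr0.
  - move=> p q [p' Mp] [q' Mq]; exists (p' + q').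
    by rewrite mulrDl opprD addrACA; apply: MD.
  - move=> g p [p' Mp]; exists (g * p').
    by rewrite -mulrA -mulrBr; apply: MM.
have [k [q Mk]] : exists k, M' (b ^+ k).
  apply: contrapT => /forallNP nk; apply: (Mmax M' MM'); right; split=> //.
  by apply: subset_trans JM _; case: MM'.
by exists k, q.
Qed.

Lemma avoiding_prime M b f g : ideal M -> (forall k, ~ M (b ^+ k)) ->
  (forall f, ~ M f -> exists k q, M (b ^+ k - q * f)) ->
  M (f * g) -> M f \/ M g.
Proof.
move=> Mi Mb Mmax Mfg; apply: contrapT => /not_orP[/Mmax[k [q Mk]] /Mmax[l [q' Ml]]].
have [_ MD MM] := Mi; apply: (Mb (k + l)%N); rewrite exprD.
have -> : b ^+ k * b ^+ l = b ^+ l * (b ^+ k - q * f) + (q * f) * (b ^+ l - q' * g)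
  + (q * q') * (f * g) by ring.
by apply: (MD); [apply: MD|]; apply: MM.
Qed.

Lemma bounded_msize_gen k : exists s : nat -> S,
  gen_mod (fun p => p = 0) (fun p => (msize p <= k)%N) #|{: 'X_{1..m < k}}| s.
Proof.
exists (fun l => if insub l is Some l' then 'X_[@enum_val 'X_{1..m < k} predT l'] else 0).
move=> p pk.
exists (fun l => if insub l is Some l' then p@_(@enum_val 'X_{1..m < k} predT l') else 0).
apply/eqP; rewrite subr_eq0 {1}(mpolywE pk) big_enum_val; apply/eqP.
by apply: eq_bigr => l _; rewrite valK.
Qed.

Lemma seq_cover_bounded (T : eqType) (P : T -> Prop) N :
  (forall s : seq T, uniq s -> (forall x, x \in s -> P x) -> (size s <= N)%N) ->
  exists s : seq T, forall x, P x -> x \in s.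
Proof.
move=> hN; suff [n] : exists n, exists s : seq T, (N - size s < n)%N /\
    uniq s /\ forall x, x \in s -> P x; last by exists N.+1, [::]; rewrite ltnS leq_subr.
elim: n => [[s []]//|n IH [s [sn [us sP]]]].
have [h|/existsNP[x /not_implyP[Px /negP xs]]] := pselect (forall x, P x -> x \in s).
  by exists s.
have uxs : uniq (x :: s) by rewrite /= xs us.
have xsP y : y \in x :: s -> P y by rewrite inE => /orP[/eqP->|/sP].
by apply: IH; exists (x :: s); split=> //; have := hN _ uxs xsP; rewrite /=; lia.
Qed.

(** A nonzero [g] splits into linear factors, so the prime [M] would contain some ['X_i - a] or a
    nonzero constant. *)
Lemma prime_horner_alg M i (g : {poly K}) b k : ideal M ->
  (forall k, ~ M (b ^+ k)) -> (forall f g, M (f * g) -> M f \/ M g) ->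
  (forall a, ~ M ('X_i - a%:MP)) -> M (b ^+ k * horner_alg 'X_i g) -> g = 0.
Proof.
move=> Mi Mb Mp Ma Mg; apply/eqP; apply: contrapT => /negP g0.
have {Mg} : M (horner_alg 'X_i g) by case: (Mp _ _ Mg) => // /Mb.
have [r ->] := closed_field_poly_normal g.
rewrite linearZ /= rmorph_prod /= -mul_mpolyC => /Mp[|].
  rewrite mulr1 => Mc.
  apply: (Mb 0%N); rewrite expr0 -(mpolyC1 m) -[1](@mulVf _ (lead_coef g)).
    by rewrite mpolyCM; case: Mi => _ _; apply.
  by rewrite lead_coef_eq0.
elim: r => [|z r IH]; first by rewrite big_nil => /(Mb 0%N).
rewrite big_cons => /Mp[|//].
by rewrite rmorphB /= horner_algX horner_algC alg_mpolyC => /Ma.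
Qed.

(** Modulo [M] the [q l] are fractions with numerator [b ^+ D] and denominators ['X_i - s_l].
    Clearing denominators in a relation gives [b ^+ D] times a combination of unnormalized Lagrange
    polynomials in ['X_i], which is zero by [prime_horner_alg]. *)
Lemma lagrange_free M i b D (s : seq K) (q : nat -> S) : ideal M ->
  (forall k, ~ M (b ^+ k)) -> (forall f g, M (f * g) -> M f \/ M g) ->
  (forall a, ~ M ('X_i - a%:MP)) -> uniq s ->
  (forall l, (l < size s)%N -> M (b ^+ D - q l * ('X_i - (s`_l)%:MP))) ->
  free_mod (fun p => p = 0) (size s) q.
Proof.
move=> Mi Mb Mp Ma us Mq c c0 l ls.
pose P l := \prod_(l' < size s | l' != l :> nat) ('X - (s`_l')%:P).
pose g : {poly K} := \sum_(l < size s) c l *: P l.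
have eXa (a : K) : horner_alg 'X_i ('X - a%:P) = 'X_i - a%:MP_[m].
  by rewrite rmorphB /= horner_algX horner_algC alg_mpolyC.
have g0 : g = 0.
  apply: (@prime_horner_alg M i g b D) => //.
  pose Q : S := \prod_(l' < size s) ('X_i - (s`_l')%:MP).
  have -> : b ^+ D * horner_alg 'X_i g = \sum_(l < size s)
     (c l *: horner_alg 'X_i (P l)) * (b ^+ D - q l * ('X_i - (s`_l)%:MP)).
    rewrite /g linear_sum /= mulr_sumr.
    have e (k : 'I_(size s)) : (c k *: horner_alg 'X_i (P k)) *
       (b ^+ D - q k * ('X_i - (s`_k)%:MP)) =
       b ^+ D * horner_alg 'X_i (c k *: P k) - (c k *: q k) * Q.
      rewrite /Q (bigD1 k) //= linearZ /= -!mul_mpolyC.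
      rewrite [horner_alg _ (P k)]rmorph_prod.
      rewrite (eq_bigr _ (fun (i0 : 'I_(size s)) _ => eXa s`_i0)); ring.
    under [RHS]eq_bigr do rewrite e.
    by rewrite sumrB -mulr_suml c0 mul0r subr0.
  by apply: ideal_sum => // k _; have [_ _] := Mi; apply; apply: Mq.
(* At the node [s_l] only the product [P l] survives. *)
have := congr1 (fun u : {poly K} => u.[s`_l]) g0; rewrite horner0 /g horner_sum.
rewrite (bigD1 (Ordinal ls)) //= big1 => [|k kl]; last first.
  rewrite hornerZ /P (bigD1 (Ordinal ls)) /=; last first.
    by rewrite eq_sym; apply: contra kl => /eqP e; apply/eqP/val_inj.
  by rewrite hornerM hornerXsubC subrr mul0r mulr0.
rewrite addr0 hornerZ => /eqP; rewrite mulf_eq0 => /orP[/eqP//|].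
rewrite /P horner_prod => /prodf_eq0[k kl]; rewrite hornerXsubC subr_eq0.
by rewrite nth_uniq // eq_sym (negPf kl).
Qed.

Lemma msizeX_le p k : (msize (p ^+ k) <= (k * msize p).+1)%N.
Proof.
elim: k => [|k IH]; first by rewrite expr0 msize1.
have [->|p0] := eqVneq p 0; first by rewrite exprS mul0r msize0.
rewrite exprS msizeM ?expf_neq0 //.
by apply: leq_trans (leq_pred _) _; rewrite mulSn -addnS leq_add2l.
Qed.

(* Otherwise the polynomials [q a] with [b ^+ D = q a * ('X_i - a)] modulo [M],
   for uncountably many [a] and [q a] of bounded degree, are linearly
   independent. *)
Lemma maximal_avoiding_root M i b : ideal M -> (forall k, ~ M (b ^+ k)) ->
  (forall f, ~ M f -> exists k q, M (b ^+ k - q * f)) ->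
  exists a, M ('X_i - a%:MP).
Proof.
move=> Mi Mb Mmax; apply: contrapT => /forallNP Ma.
have Mp f g : M (f * g) -> M f \/ M g by apply: avoiding_prime Mmax.
have [_ MD MM] := Mi.
(* The [a] for which ['X_i - a] has an inverse of complexity at most [D]; every [a] belongs to some
   [A D], and each [A D] turns out to be finite. *)
pose A D (a : K) := exists k q, [/\ (k <= D)%N, (msize q <= D)%N &
  M (b ^+ k - q * ('X_i - a%:MP))].
have Acov D : exists s : seq K, forall a, A D a -> a \in s.
  (* Size bound for [b ^+ (D - k) * q], which brings all the witnesses to the common exponent
     [D]. *)
  pose N := (D + (D * msize b).+1).+1.
  apply: (@seq_cover_bounded _ (A D) #|{: 'X_{1..m < N}}|) => s us sA.
  have /choice[q hq] (l : nat) : exists q, (l < size s)%N ->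
      (msize q <= N)%N /\ M (b ^+ D - q * ('X_i - (s`_l)%:MP)).
    have [ls|] := ltnP l (size s); last by exists 0.
    have [k [q [kD qD Mq]]] := sA _ (mem_nth 0 ls).
    exists (b ^+ (D - k) * q) => _; split; last first.
      rewrite -{1}(subnK kD) exprD -mulrA -mulrBr; exact: MM.
    apply: leq_trans (msizeM_le _ _) _.
    rewrite /N ltnS [leqRHS]addnC; apply: leq_add => //.
    apply: leq_trans (msizeX_le _ _) _.
    by rewrite ltnS leq_mul2r leq_subr orbT.
  have [t ht] := bounded_msize_gen N.
  apply: (free_gen_leq (I := fun p => p = 0) _ ht (t := q)).
  - by split=> // a p p' -> ->; rewrite scaler0 addr0.
  - by move=> l ls; apply: (hq l ls).1.
  - by apply: (@lagrange_free M i b D) => // l ls; apply: (hq l ls).2.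
have /choice[s hs] := Acov.
(* A real number outside the real parts of all the lists can lie in no [A D]. *)
have [x hx] := real_uncountable (fun D => map (@complex.Re R) (s D)).
have [k [q Mq]] := Mmax _ (Ma x%:C%C).
have /hs xs : A (maxn k (msize q)) x%:C%C.
  by exists k, q; split=> //; rewrite ?leq_maxl ?leq_maxr.
by have /negP := hx (maxn k (msize q)); apply; apply/mapP; exists x%:C%C.
Qed.

(** Otherwise a maximal [M] avoiding the powers of [b] contains ['X_i - z i] for some [z]; then
    every polynomial is congruent to its value at [z], so [z] is a zero of [J], [b] vanishes there,
    and [b] lies in [M]. *)
Lemma nullstellensatz J b : ideal J ->
  (forall z : 'I_m -> K, (forall p, J p -> p.@[z] = 0) -> b.@[z] = 0) ->
  exists k, J (b ^+ k).
Proof.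
move=> Ji Jb; apply: contrapT => /forallNP nJb.
have [M [Mi JM Mb Mmax]] := ex_maximal_avoiding Ji nJb.
have /choice[z Mz] i := maximal_avoiding_root i Mi Mb Mmax.
have [M0 MD MM] := Mi.
have Me p : M (p - (p.@[z])%:MP).
  have hD q q' : M (q - (q.@[z])%:MP) -> M (q' - (q'.@[z])%:MP) ->
      M (q + q' - ((q + q').@[z])%:MP).
    by move=> h h'; rewrite mevalD mpolyCD opprD addrACA; apply: MD.
  have hM q q' : M (q - (q.@[z])%:MP) -> M (q' - (q'.@[z])%:MP) ->
      M (q * q' - ((q * q').@[z])%:MP).
    move=> h h'; rewrite mevalM mpolyCM.
    have -> : q * q' - q.@[z]%:MP * q'.@[z]%:MP = q' * (q - q.@[z]%:MP) +
      q.@[z]%:MP * (q' - q'.@[z]%:MP) by ring.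
    by apply: MD; apply: MM.
  have hC c : M (c%:MP - (c%:MP.@[z])%:MP) by rewrite mevalC subrr.
  rewrite [p]mpolyE; elim/big_ind: _ => [||a _]; first by rewrite -(mpolyC0 m).
    exact: hD.
  rewrite -mul_mpolyC; apply: (hM) => //; rewrite mpolyXE_id.
  elim/big_ind: _ => [||i _]; first by rewrite -(mpolyC1 m).
    exact: (hM).
  elim: (a i) => [|k IH]; first by rewrite expr0 -(mpolyC1 m).
  by rewrite exprS; apply: hM => //; rewrite mevalXU.
have Mc c : M c%:MP -> c = 0.
  move=> Mc; apply/eqP; apply: contrapT => /negP c0; apply: (Mb 0%N).
  by rewrite expr0 -(mpolyC1 m) -[1](mulVf c0) mpolyCM; apply: MM.
have b0 : b.@[z] = 0.
  apply: Jb => p Jp; apply: Mc; have -> : (p.@[z])%:MP = p - (p - (p.@[z])%:MP).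
    by rewrite opprB addrC subrK.
  by apply: idealB => //; apply: JM.
by apply: (Mb 1%N); rewrite expr1; have := Me b; rewrite b0 mpolyC0 subr0.
Qed.

End Nullstellensatz.

(** * Gradings by positive primitive relations *)

Section Rays.
Variable r : nat.
Implicit Types (i j : 'I_r) (rho : 'I_(r + r)) (e : 'I_r -> bool).

Definition position rho : 'I_r :=
  match fintype.split rho with inl i => i | inr i => i end.

(** A sign vector [e] stands for the maximal cone on the rays [ray e i]; [negb \o e] gives the
    opposite cone. *)
Definition ray e i : 'I_(r + r) := if e i then minus i else plus i.

Lemma position_plus i : position (plus i) = i.
Proof. by rewrite /position /plus -[lshift _ _]/(unsplit (inl i)) unsplitK. Qed.

Lemma position_minus i : position (minus i) = i.
Proof. by rewrite /position /minus -[rshift _ _]/(unsplit (inr i)) unsplitK. Qed.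

Lemma position_ray e i : position (ray e i) = i.
Proof. by rewrite /ray; case: (e i); rewrite (position_plus, position_minus). Qed.

Lemma plus_or_minus rho : rho = plus (position rho) \/ rho = minus (position rho).
Proof.
rewrite -[rho]splitK; case: (fintype.split rho) => i /=.
  by left; rewrite position_plus.
by right; rewrite position_minus.
Qed.

Lemma plus_neq_minus i j : (plus i == minus j) = false.
Proof. by rewrite /plus /minus eq_lrshift. Qed.

Lemma ray_or_opposite e rho :
  rho = ray e (position rho) \/ rho = ray (negb \o e) (position rho).
Proof.
by rewrite /ray /=; case: (e _) => /=; case: (plus_or_minus rho); auto.
Qed.

Lemma ray_neq_opposite e i : ray e i == ray (negb \o e) i = false.
Proof.
by rewrite /ray /=; case: (e i) => /=; rewrite ?(eq_sym (minus i)) plus_neq_minus.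
Qed.

Lemma sum_rays (V : nmodType) e (f : 'I_(r + r) -> V) :
  \sum_rho f rho = \sum_i (f (ray e i) + f (ray (negb \o e) i)).
Proof.
rewrite big_split_ord /= -big_split /=; apply: eq_bigr => i _.
by rewrite /ray /=; case: (e i) => //=; rewrite addrC.
Qed.

End Rays.

(* The primitive relations e_i^+ + e_i^- = sum_rho (c i rho) u_rho have
   nonnegative coefficients and involve on the right only rays of positions
   greater than i; their matrix gives the classes of divisors in Pic = Z^r. *)
Section PositiveGrading.
Variables (r : nat) (c : 'I_r -> 'I_(r + r) -> nat).
Implicit Types (i j : 'I_r) (rho : 'I_(r + r)) (e : 'I_r -> bool).
Implicit Types (D : 'rV[int]_(r + r)) (n : 'rV[int]_r) (a : 'X_{1..r + r}).

Definition relmx : 'M[int]_(r + r, r) :=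
  \matrix_(rho, i) ((position rho == i)%:R - (c i rho)%:Z).

Definition monrow a : 'rV[int]_(r + r) := \row_rho (a rho)%:Z.
Definition mondeg a : 'rV[int]_r := monrow a *m relmx.

Hypothesis c_gt : forall i rho, c i rho != 0%N -> (i < position rho)%N.

Lemma relmx_mulE e D i : (D *m relmx) ord0 i =
  D ord0 (ray e i) + D ord0 (ray (negb \o e) i)
  - \sum_rho D ord0 rho * (c i rho)%:Z.
Proof.
rewrite mxE; under eq_bigr do rewrite mxE mulrBr.
rewrite sumrB; congr (_ - _).
rewrite (sum_rays e) (bigD1 i) //= big1 ?addr0 => [|j /negPf ji].
  by rewrite !position_ray eqxx !mulr1.
by rewrite !position_ray ji !mulr0 addr0.
Qed.

Lemma mondegE e a i : mondeg a ord0 i =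
  (a (ray e i) + a (ray (negb \o e) i))%N%:Z - (\sum_rho a rho * c i rho)%N%:Z.
Proof.
rewrite /mondeg (relmx_mulE e) !mxE PoszD; congr (_ - _).
by rewrite -!natz natr_sum; apply: eq_bigr => rho _; rewrite !natz mxE PoszM.
Qed.

Lemma mondeg0 : mondeg 0 = 0.
Proof. by apply/rowP => i; rewrite !mxE big1 // => j _; rewrite mxE mnm0E mul0r. Qed.

Lemma mondegD a b : mondeg (a + b)%MM = mondeg a + mondeg b.
Proof.
rewrite /mondeg -mulmxDl; congr (_ *m _); apply/rowP => rho.
by rewrite !mxE mnmDE PoszD.
Qed.

(** Class coordinate [i] involves, besides the two rays at position [i], only rays of greater
    positions; hence a descending induction on the position. *)
Lemma relmx_mul_inj e D : D *m relmx = 0 -> (forall i, D ord0 (ray e i) = 0) ->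
  D = 0.
Proof.
move=> D0 De; apply/rowP => rho; rewrite mxE.
have [n] := ubnP (r - position rho); elim: n rho => // n IH rho ltn.
case: (ray_or_opposite e rho) => [->//|Erho].
move/rowP/(_ (position rho)): D0; rewrite (relmx_mulE e) De add0r -Erho mxE.
rewrite big1 ?subr0 // => rho' _.
have [->|/c_gt lt] := eqVneq (c (position rho) rho') 0%N; first by rewrite mulr0.
by rewrite IH ?mul0r //; have := ltn_ord (position rho'); lia.
Qed.

Lemma mondeg_inj e a b : mondeg a = mondeg b ->
  (forall i, a (ray e i) = b (ray e i)) -> a = b.
Proof.
move=> ab abe; apply/mnmP => rho; apply/eqP; rewrite -eqz_nat -subr_eq0.
have : monrow a - monrow b = 0.
  apply: (@relmx_mul_inj e); first by rewrite mulmxBl; apply/eqP; rewrite subr_eq0 -/(mondeg a) ab.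
  by move=> i; rewrite !mxE abe subrr.
by move/rowP/(_ rho); rewrite !mxE => ->.
Qed.

(* A divisor of nonnegative class is linearly equivalent, for every maximal
   cone, to an effective one that avoids the corresponding fixed point. *)
Lemma ex_mondeg e n (v : 'I_r -> nat) : (forall i, (v i)%:Z <= n ord0 i) ->
  exists2 a, mondeg a = n & forall i, a (ray e i) = v i.
Proof.
move=> vn.
(* The opposite exponents are filled in from the last position down; [k] positions are done. *)
have ind k : (k <= r)%N ->
    exists f : 'I_(r + r) -> nat, (forall i, f (ray e i) = v i) /\
    forall i, (r - k <= i)%N ->
    ((f (ray e i))%:Z + (f (ray (negb \o e) i))%:Z =
       n ord0 i + (\sum_rho f rho * c i rho)%N%:Z); last first.
  have [f [fv fn]] := ind r (leqnn r).
  exists [multinom f rho | rho < r + r]; last by move=> i; rewrite mnmE.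
  apply/rowP => i; rewrite (mondegE e) !mnmE.
  by under eq_bigr do rewrite mnmE; rewrite PoszD fn ?subnn // addrK.
elim: k => [|k IH] kr.
  exists (fun rho => v (position rho)); split=> [i|i]; first by rewrite position_ray.
  by rewrite subn0 leqNgt ltn_ord.
have [f [fv fn]] := IH (ltnW kr).
have ik : (r - k.+1 < r)%N by lia.
pose i0 := Ordinal ik.
(* The value forced by class coordinate [i0]; the bound on [v i0] makes the truncated subtraction
   exact. *)
pose x := (`|n ord0 i0| - v i0 + \sum_rho f rho * c i0 rho)%N.
pose f' rho := if rho == ray (negb \o e) i0 then x else f rho.
have f'e i : f' (ray e i) = f (ray e i).
  rewrite /f'; case: eqP => // h; have := congr1 (@position r) h.
  by rewrite !position_ray => E; move: h; rewrite E => /eqP; rewrite ray_neq_opposite.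
have f's i : (r - k.+1 <= i)%N ->
    (\sum_rho f' rho * c i rho = \sum_rho f rho * c i rho)%N.
  move=> ki; apply: eq_bigr => rho _; rewrite /f'; case: eqP => // ->.
  have [->|/c_gt] := eqVneq (c i (ray (negb \o e) i0)) 0%N; first by rewrite !muln0.
  by rewrite position_ray /= ltnNge ki.
exists f'; split=> [i|i ki]; first by rewrite f'e.
rewrite f's // f'e; have [->|ne] := eqVneq i i0.
  rewrite /f' eqxx /x fv; have := vn i0; lia.
rewrite /f' ifF; last first.
  apply/negP => /eqP /(congr1 (@position r)); rewrite !position_ray => h.
  by rewrite h eqxx in ne.
by apply: fn; move: ne; rewrite -val_eqE /=; lia.
Qed.

(** Bounds at the greater positions bound the correction term, hence both exponents at the current
    one. This makes the graded pieces finite-dimensional. *)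
Lemma mondeg_bounded n : exists B, forall a, mondeg a = n -> (mdeg a < B)%N.
Proof.
have ind k : (k <= r)%N -> exists B, forall a, mondeg a = n ->
    forall rho, (r - k <= position rho)%N -> (a rho <= B)%N; last first.
  have [B hB] := ind r (leqnn r).
  exists (((r + r) * B).+1) => a an; rewrite mdegE ltnS.
  rewrite -[X in (X * _)%N]card_ord -sum_nat_const.
  by apply: leq_sum => rho _; apply: hB; rewrite ?subnn.
elim: k => [|k IH] kr.
  by exists 0%N => a _ rho; rewrite subn0 leqNgt ltn_ord.
have [B hB] := IH (ltnW kr).
have ik : (r - k.+1 < r)%N by lia.
pose i0 := Ordinal ik.
exists (B + `|n ord0 i0| + \sum_rho B * c i0 rho)%N => a an rho krho.
have [h|ne] := eqVneq (position rho) i0; last first.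
  have := hB _ an rho; move: ne krho; rewrite -val_eqE /= => ne krho.
  by move=> /(_ _)/leq_trans -> //; [lia|rewrite -addnA leq_addr].
have hs : (\sum_rho a rho * c i0 rho <= \sum_rho B * c i0 rho)%N.
  apply: leq_sum => rho' _.
  have [->|/c_gt lt] := eqVneq (c i0 rho') 0%N; first by rewrite !muln0.
  by rewrite leq_mul2r hB ?orbT //; move: lt; rewrite /=; lia.
have := congr1 (fun M : 'rV_r => M ord0 i0) an.
rewrite /= (mondegE (fun=> false)) /ray /=; move: hs.
move: (\sum_rho a rho * c i0 rho)%N (\sum_rho B * c i0 rho)%N => s1 s2.
by case: (plus_or_minus rho) => ->; rewrite h; lia.
Qed.

Lemma mondeg_sum_ge a i : mondeg a ord0 i <= (a (plus i) + a (minus i))%N%:Z.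
Proof. by rewrite (mondegE (fun=> false)) /ray /=; lia. Qed.

End PositiveGrading.

(** * Vanishing ideals in Cox coordinates *)

Section VanishingIdeal.
Variables (R : realType) (m : nat) (Z : set 'rV[R[i]]_m).
Implicit Types p q : {mpoly R[i][m]}.

Definition vanishing p := Z `<=` zeros p.

Lemma vanishing_submodule : submodule (K := R[i]) vanishing.
Proof.
split=> [z _|a p q vp vq z Zz]; first by rewrite /zeros /= meval0.
have := vq z Zz; have := vp z Zz.
by rewrite /zeros /= mevalD mevalZ => -> ->; rewrite mulr0 addr0.
Qed.

Lemma vanishingMl p q : vanishing q -> vanishing (p * q).
Proof. by move=> vq z /vq; rewrite /zeros /= mevalM => ->; rewrite mulr0. Qed.

Lemma vanishingMr p q : vanishing p -> vanishing (p * q).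
Proof. by rewrite mulrC; apply: vanishingMl. Qed.

End VanishingIdeal.

(** The interface between combinatorics and geometry: relations triangular in the positions,
    right-hand sides supported on cones, divisor classes read in Z^r through [relmx], and the cones
    of the fan. *)
Record positive_fan (r : nat) (F : fan r (r + r)) (c : 'I_r -> 'I_(r + r) -> nat) :
    Prop := PositiveFan {
  relation_gt : forall i rho, c i rho != 0%N -> (i < position rho)%N;
  relation_cone : forall i j, c i (plus j) = 0%N \/ c i (minus j) = 0%N;
  lin_equiv_relations : forall D D',
    lin_equiv F D D' <-> D *m relmx c = D' *m relmx c;
  cones_sign : forall sigma : {set 'I_(r + r)}, (sigma \in cones F) =
    [forall i : 'I_r, ~~ ((plus i \in sigma) && (minus i \in sigma))] }.

(** * The graded Cox ring, nef classes and intersection numbers *)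

Section CoxRing.
Variables (R : realType) (r : nat) (F : fan r (r + r)).
Variable c : 'I_r -> 'I_(r + r) -> nat.
Local Notation K := R[i].
Local Notation S := {mpoly K[r + r]}.
Implicit Types (i j : 'I_r) (rho : 'I_(r + r)) (e : 'I_r -> bool).
Implicit Types (D : 'rV[int]_(r + r)) (n : 'rV[int]_r) (a : 'X_{1..r + r}).
Implicit Types (p q f g s t : S) (Z : set 'rV[K]_(r + r)) (z : 'rV[K]_(r + r)).

Definition nonneg n := forall i, 0 <= n ord0 i.

Definition homogeneous n : set S := [set p | forall a, a \in msupp p -> mondeg c a = n].

Lemma homogeneous_submodule n : submodule (K := K) (homogeneous n).
Proof.
split=> [a|x p q hp hq a]; first by rewrite msupp0.
by move=> /msuppD_le; rewrite mem_cat => /orP[/msuppZ_le/hp|/hq].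
Qed.

Lemma homogeneousM n n' p q : homogeneous n p -> homogeneous n' q -> homogeneous (n + n') (p * q).
Proof.
move=> hp hq a /msuppM_le/allpairsP[[b b'] [/hp pb /hq qb ->]] /=.
by rewrite mondegD pb qb.
Qed.

Lemma homogeneousX a : homogeneous (mondeg c a) 'X_[a].
Proof. by move=> b; rewrite msuppX inE => /eqP->. Qed.

Lemma homogeneous_sum_monomials (J : S -> Prop) n p : submodule (K := K) J ->
  homogeneous n p -> (forall a, mondeg c a = n -> J 'X_[a]) -> J p.
Proof.
move=> sJ hp hJ; rewrite [p]mpolyE big_seq; apply: submodule_sum => // a /hp pa.
by apply: submoduleZ => //; apply: hJ.
Qed.

Lemma mem_msupp_meval p z : p.@[z ord0] != 0 ->
  exists2 a, a \in msupp p & ('X_[a] : S).@[z ord0] != 0.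
Proof.
move=> p0; apply: contrapT => /forall2NP nz; move/eqP: p0; apply.
rewrite [p]mpolyE raddf_sum /= big_seq big1 // => a pa; rewrite mevalZ.
have [//|/negP] := nz a; rewrite negbK => /eqP ->.
by rewrite mulr0.
Qed.

Lemma meval_monomial_neq0 a z :
  (forall rho, a rho != 0%N -> z ord0 rho != 0) <-> ('X_[a] : S).@[z ord0] != 0.
Proof.
rewrite mevalX; split.
  move=> h; apply/prodf_neq0 => rho _.
  have [->|/h z0] := eqVneq (a rho) 0%N; first by rewrite expr0 oner_neq0.
  by rewrite expf_neq0.
move=> /prodf_neq0 h rho a0; have := h rho isT.
by apply: contra => /eqP ->; rewrite expr0n (negPf a0).
Qed.

Hypothesis Fc : positive_fan F c.
Local Notation c_gt := (relation_gt Fc).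
Local Notation c_cone := (relation_cone Fc).
Local Notation linF := (lin_equiv_relations Fc).
Local Notation conesF := (cones_sign Fc).

Lemma sectionsE D : sections F D = homogeneous (D *m relmx c).
Proof.
apply/seteqP; split=> p hp a /hp; first by move/linF=> ->.
by move=> pa; apply/linF; rewrite -pa.
Qed.

Lemma homogeneous_sections n p : homogeneous n p -> exists D, sections F D p.
Proof.
move=> hp; have [->|] := eqVneq p 0; first by exists 0 => a; rewrite msupp0.
rewrite -msupp_eq0; case E : (msupp p) => [//|a s] _.
have pa : a \in msupp p by rewrite E mem_head.
by exists (monrow a); rewrite sectionsE -/(mondeg c a) (hp _ pa).
Qed.

Lemma XhatE z : Xhat F z <-> forall i, z ord0 (plus i) != 0 \/ z ord0 (minus i) != 0.
Proof.
rewrite /Xhat /= conesF; split=> [/forallP h i|h].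
  by have := h i; rewrite !inE negb_and => /orP.
by apply/forallP => i; rewrite !inE negb_and; apply/orP.
Qed.

(** All zero coordinates of [z] are rays of the maximal cone of [e], and [ex_mondeg] gives a
    monomial that avoids this cone. *)
Lemma ex_monomial_neq0 n z : nonneg n -> Xhat F z ->
  exists2 a, mondeg c a = n & ('X_[a] : S).@[z ord0] != 0.
Proof.
move=> n0 /XhatE hz; pose e i := z ord0 (minus i) == 0.
have [//|a an ae] := ex_mondeg c_gt e (n := n) (v := fun=> 0%N).
exists a => //; apply/meval_monomial_neq0 => rho.
case: (ray_or_opposite e rho) => ->; first by rewrite ae.
move=> _; rewrite /ray /= /e; have [h|//] := eqVneq (z ord0 (minus (position rho))) 0 => /=.
by case: (hz (position rho)) => //; rewrite h eqxx.
Qed.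

Lemma ex_section_neq0 n z : nonneg n -> Xhat F z ->
  exists2 p, homogeneous n p & p.@[z ord0] != 0.
Proof.
move=> n0 /(ex_monomial_neq0 n0)[a an a0].
by exists 'X_[a] => //; rewrite -an; apply: homogeneousX.
Qed.

Lemma ex_divisor n : nonneg n -> exists D, D *m relmx c = n.
Proof.
move=> n0; have [//|a an _] := ex_mondeg c_gt (fun=> true) (n := n) (v := fun=> 0%N).
by exists (monrow a).
Qed.

Lemma c_ray i : exists e, forall rho, c i rho != 0%N -> rho = ray e (position rho).
Proof.
exists (fun j => c i (minus j) != 0%N) => rho c0; rewrite /ray.
case: (c_cone i (position rho)) => h; last first.
  by rewrite h eqxx /=; case: (plus_or_minus rho) => // E; rewrite E h in c0.
case: (plus_or_minus rho) => E; first by rewrite E h in c0.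
by rewrite -E c0.
Qed.

(** A monomial that does not vanish at the fixed point of a maximal cone containing the right-hand
    side of relation [i] has zero exponents on that cone, so its class coordinate [i] has no
    negative term. *)
Lemma globally_generatedE D : globally_generated R F D <-> nonneg (D *m relmx c).
Proof.
split=> [gD i|D0 z]; last by rewrite sectionsE; apply: ex_section_neq0.
have [e he] := c_ray i.
pose z : 'rV[K]_(r + r) := \row_rho (rho != ray e (position rho))%:R.
have ze j : z ord0 (ray e j) = 0 by rewrite mxE position_ray eqxx.
have zo j : z ord0 (ray (negb \o e) j) = 1.
  by rewrite mxE position_ray eq_sym ray_neq_opposite.
have Xz : Xhat F z.
  apply/XhatE => j; have := zo j; rewrite /ray /=; case: (e j) => /= ->.
    by left; apply: oner_neq0.
  by right; apply: oner_neq0.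
have [p] := gD _ Xz; rewrite sectionsE => hp /mem_msupp_meval[a /hp <-].
move/meval_monomial_neq0 => az; rewrite (mondegE _ (fun=> false)) big1 ?subr0 //.
move=> rho _; have [->|/he rhoe] := eqVneq (c i rho) 0%N; first by rewrite muln0.
have [->|/az] := eqVneq (a rho) 0%N; first by rewrite mul0n.
by rewrite {1}rhoe ze eqxx.
Qed.

Lemma zclosedE Z : zclosed F Z <-> exists T : set S,
  (forall p, T p -> exists n, homogeneous n p) /\ Z = Xhat F `&` \bigcap_(p in T) zeros p.
Proof.
split=> -[T [hT ->]]; exists T; split=> // p /hT[].
  by move=> D; rewrite sectionsE => pD; exists (D *m relmx c).
by move=> n /homogeneous_sections.
Qed.

(** The multigraded Hilbert function of the homogeneous coordinate ring of [Z]; by [hilbP] the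
    dimension always exists. *)
Definition hilb Z n := xget 0%N [set d | is_dim (vanishing Z) (homogeneous n) d].

Lemma homogeneous_free_bounded Z n : exists B, forall d (s : nat -> S),
  (forall k, (k < d)%N -> homogeneous n (s k)) -> free_mod (vanishing Z) d s -> (d <= B)%N.
Proof.
have [B hB] := mondeg_bounded c_gt n.
have [t ht] := bounded_msize_gen R (r + r) B.
exists #|{: 'X_{1..(r + r) < B}}| => d s hs fs.
apply: (free_gen_leq _ ht (t := s)).
- by split=> // a p q -> ->; rewrite scaler0 addr0.
- move=> k /hs sk; rewrite msizeE; apply/bigmax_leqP_seq => a /sk/hB.
  by [].
- move=> a a0; apply: fs; rewrite a0; exact: submodule0 (vanishing_submodule Z).
Qed.

Lemma hilbP Z n : is_dim (vanishing Z) (homogeneous n) (hilb Z n).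
Proof.
have [B hB] := homogeneous_free_bounded Z n; have [d hd] := ex_dim (vanishing_submodule Z) hB.
exact: (@xgetPex _ 0%N [set d | is_dim (vanishing Z) (homogeneous n) d]) (ex_intro _ d hd).
Qed.

Lemma hilb_eq Z n d : is_dim (vanishing Z) (homogeneous n) d -> hilb Z n = d.
Proof. exact: (is_dim_uniq (vanishing_submodule Z) (hilbP Z n)). Qed.

Lemma is_coord_dimE Z D d :
  is_coord_dim F Z D d <-> is_dim (vanishing Z) (homogeneous (D *m relmx c)) d.
Proof.
rewrite /is_coord_dim sectionsE; pose ext (T : nmodType) (u : 'I_d -> T) (k : nat) :=
  if insub k is Some k' then u k' else 0.
have extE (T : nmodType) (u : 'I_d -> T) (k : 'I_d) : ext T u k = u k.
  by rewrite /ext valK.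
split=> [[s [hs fs gs]]|[s [hs fs gs]]].
- exists (ext _ s); split.
  + by move=> k kd; rewrite -[k]/(val (Ordinal kd)) extE; apply: hs.
  + move=> a va k kd; apply: (fs (fun k => a k) _ (Ordinal kd)).
    rewrite (eq_bigr (fun l : 'I_d => a l *: ext _ s l)) // => l _.
    by rewrite extE.
  + move=> p /gs[a va]; exists (ext _ a).
    rewrite (eq_bigr (fun l : 'I_d => a l *: s l)) // => l _.
    by rewrite !extE.
- exists (fun k => s k); split; first by move=> k; apply: hs.
  + move=> a va k; rewrite -(extE _ a); apply: fs => //.
    rewrite (eq_bigr (fun l : 'I_d => a l *: s l)) // => l _.
    by rewrite /ext valK.
  + by move=> p /gs[a va]; exists (fun k => a k).
Qed.

Lemma coord_dimE Z D : coord_dim F Z D = hilb Z (D *m relmx c).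
Proof.
rewrite /coord_dim /hilb; congr (xget _ _).
by apply/seteqP; split=> d /= /is_coord_dimE.
Qed.

Definition lev n n' := forall i, n ord0 i <= n' ord0 i.

(** Beyond [A], adding the class of [D] changes the Hilbert function by the linear part. Any other
    candidate agrees, since it can be tested at a globally generated [N] large enough to reach the
    affine range. *)
Lemma intersection_numberE Z D (A : 'rV[int]_r) (h : 'cV[int]_r) (b : int) :
  (forall n, lev A n -> (hilb Z n)%:Z = b + (n *m h) ord0 ord0) ->
  intersection_number F D Z = (D *m relmx c *m h) ord0 ord0.
Proof.
move=> hA; pose x : int := (D *m relmx c *m h) ord0 ord0.
have diff n : lev A n -> lev A (n + D *m relmx c) ->
    (hilb Z (n + D *m relmx c))%:Z - (hilb Z n)%:Z = x.
  by move=> h1 h2; rewrite !hA // mulmxDl [X in b + X - _]mxE /x; ring.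
have isx : is_intersection_number F D Z x.
  pose n : 'rV[int]_r := \row_i (`|A ord0 i| + `|(D *m relmx c) ord0 i|).
  have [|A0 A0n] := @ex_divisor n; first by move=> i; rewrite mxE; lia.
  exists A0 => N /globally_generatedE N0; rewrite !coord_dimE !mulmxDl A0n diff //.
    move=> i; have := N0 i; rewrite /n.
    move: (N *m _) (D *m _) => dN dD; rewrite !mxE.
    by move: (A ord0 i) (dN ord0 i) (dD ord0 i) => x1 x2 x3; lia.
  move=> i; have := N0 i; rewrite /n.
  move: (N *m _) (D *m _) => dN dD; rewrite !mxE.
  by move: (A ord0 i) (dN ord0 i) (dD ord0 i) => x1 x2 x3; lia.
apply: (xget_unique 0 (P := [set d | is_intersection_number F D Z d]) isx).
move=> d [A0 hd].
pose n : 'rV[int]_r := \row_i (`|(A0 *m relmx c) ord0 i| + `|A ord0 i| +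
   `|(D *m relmx c) ord0 i|).
have [|N Nn] := @ex_divisor n; first by move=> i; rewrite mxE; lia.
rewrite (hd N); last by apply/globally_generatedE => i; rewrite Nn mxE; lia.
rewrite !coord_dimE !mulmxDl Nn diff //.
  move=> i; rewrite /n; move: (A0 *m _) (D *m _) => dA dD; rewrite !mxE.
  by move: (A ord0 i) (dA ord0 i) (dD ord0 i) => x1 x2 x3; lia.
move=> i; rewrite /n; move: (A0 *m _) (D *m _) => dA dD; rewrite !mxE.
by move: (A ord0 i) (dA ord0 i) (dD ord0 i) => x1 x2 x3; lia.
Qed.

End CoxRing.

(** * Hilbert functions of irreducible curves *)

Section HilbertFunction.
Variables (R : realType) (r : nat) (F : fan r (r + r)).
Variable c : 'I_r -> 'I_(r + r) -> nat.
Hypothesis Fc : positive_fan F c.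
Local Notation K := R[i].
Local Notation S := {mpoly K[r + r]}.
Local Notation homogeneous := (@homogeneous R r c).
Local Notation hilb := (@hilb R r c).
Implicit Types (i j : 'I_r) (rho : 'I_(r + r)) (e : 'I_r -> bool).
Implicit Types (D : 'rV[int]_(r + r)) (n : 'rV[int]_r) (a b : 'X_{1..r + r}).
Implicit Types (p q f g s t : S) (Z : set 'rV[K]_(r + r)) (z : 'rV[K]_(r + r)).

Lemma zclosedI_zeros Z p n : zclosed F Z -> homogeneous n p ->
  zclosed F (Z `&` zeros p).
Proof.
move=> /(zclosedE Fc)[T [hT ->]] pn; apply/(zclosedE Fc).
exists (T `|` [set p]); split; first by move=> q [/hT//|->]; exists n.
by rewrite bigcap_setU bigcap_set1 setIA.
Qed.

(** [Z] is the union of its closed subsets cut out by [p] and by [q]. *)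
Lemma zirreducible_prime Z p q n n' : zirreducible F Z ->
  homogeneous n p -> homogeneous n' q -> vanishing Z (p * q) ->
  vanishing Z p \/ vanishing Z q.
Proof.
move=> [Zc _ Zi] pn qn' vpq.
have [||| h|h] := Zi (Z `&` zeros p) (Z `&` zeros q).
- exact: zclosedI_zeros pn.
- exact: zclosedI_zeros qn'.
- rewrite -setIUr; apply/esym/setIidl => z /vpq.
  rewrite /zeros /= mevalM => /eqP; rewrite mulf_eq0.
  by case/orP => /eqP; [left|right].
- by left; rewrite h => z [].
- by right; rewrite h => z [].
Qed.

Lemma hilb_free_leq Z n d (u : nat -> S) : (forall k, (k < d)%N -> homogeneous n (u k)) ->
  free_mod (vanishing Z) d u -> (d <= hilb Z n)%N.
Proof.
have [v [_ _ gv]] := hilbP Fc Z n.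
exact: free_gen_leq (vanishing_submodule Z) _ _ _ _ gv.
Qed.

Lemma hilb_gen_leq Z n d (u : nat -> S) :
  gen_mod (vanishing Z) (homogeneous n) d u -> (hilb Z n <= d)%N.
Proof.
have [v [hv fv _]] := hilbP Fc Z n => gu.
exact: free_gen_leq (vanishing_submodule Z) _ _ _ _ gu hv fv.
Qed.

Lemma free_mul Z n d k s (u : nat -> S) : zirreducible F Z -> homogeneous d s ->
  ~ vanishing Z s -> (forall l, (l < k)%N -> homogeneous n (u l)) ->
  free_mod (vanishing Z) k u -> free_mod (vanishing Z) k (fun l => s * u l).
Proof.
move=> Zi hs sZ hu fu a va; apply: fu.
have [|| /sZ//|//] := @zirreducible_prime Z s (\sum_(l < k) a l *: u l) d n Zi hs.
  have sH := homogeneous_submodule R c n.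
  by apply: submodule_sum => // l _; apply: (submoduleZ _ sH); apply: hu.
rewrite mulr_sumr; under eq_bigr do rewrite -scalerAr.
by [].
Qed.

Lemma leq_hilb Z n d s : zirreducible F Z -> homogeneous d s -> ~ vanishing Z s ->
  (hilb Z n <= hilb Z (d + n))%N.
Proof.
move=> Zi hs sZ; have [u [hu fu gu]] := hilbP Fc Z n.
apply: hilb_free_leq (free_mul Zi hs sZ hu fu) => k kd.
by apply: homogeneousM => //; apply: hu.
Qed.

(* [p] belongs to the ideal [(s, t)] of the homogeneous coordinate ring of
   [Z], with coefficients of the expected classes. *)
Definition in_pencil Z s t d1 d2 n p := exists f1 f2,
  [/\ homogeneous (n - d1) f1, homogeneous (n - d2) f2 &
      vanishing Z (p - (s * f1 + t * f2))].

Lemma in_pencil_submodule Z s t d1 d2 n :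
  submodule (K := K) (in_pencil Z s t d1 d2 n).
Proof.
have sH m := homogeneous_submodule R c m.
split; first exists 0, 0.
  split; try exact: submodule0.
  by rewrite !mulr0 addr0 subrr; apply: submodule0 (vanishing_submodule Z).
move=> x p q [f1 [f2 [h1 h2 h3]]] [g1 [g2 [h1' h2' h3']]].
exists (x *: f1 + g1), (x *: f2 + g2); split; [exact: (sH _).2|exact: (sH _).2|].
have -> : x *: p + q - (s * (x *: f1 + g1) + t * (x *: f2 + g2)) =
   x *: (p - (s * f1 + t * f2)) + (q - (s * g1 + t * g2)).
  by rewrite -!mul_mpolyC; ring.
exact: (vanishing_submodule Z).2.
Qed.

Lemma big_nat_split (V : nmodType) k l (G : nat -> V) :
  \sum_(i < k + l) G i = \sum_(i < k) G i + \sum_(i < l) G (k + i)%N.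
Proof. by rewrite big_split_ord. Qed.

(* Grassmann's formula for the subspaces [s R_(n + d2)] and [t R_(n + d1)], whose
   intersection contains [s t R_n]. *)
Lemma hilb_pencil_leq Z s t d1 d2 n : zirreducible F Z ->
  homogeneous d1 s -> ~ vanishing Z s -> homogeneous d2 t ->
  (forall p, homogeneous (n + d1 + d2) p ->
    in_pencil Z s t d1 d2 (n + d1 + d2) p) ->
  (hilb Z (n + d1 + d2) + hilb Z n <= hilb Z (n + d1) + hilb Z (n + d2))%N.
Proof.
move=> Zi hs sZ ht hp.
have [f [hf ff gf]] := hilbP Fc Z n.
have [v [hv fv gv]] := hilbP Fc Z (n + d2).
have sfn k : (k < hilb Z n)%N -> homogeneous (n + d1) (s * f k).
  by move=> /hf; rewrite addrC; apply: homogeneousM.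
(* A basis [u] of the piece of class [n + d1] that starts with [s] times a basis of the piece of
   class [n]. *)
have [|b [u [ab uE hu fu gu]]] :=
    free_extend (vanishing_submodule Z) (B := hilb Z (n + d1)) _ sfn (free_mul Zi hs sZ hf ff).
  exact: hilb_free_leq.
have -> : hilb Z (n + d1) = b by apply: (hilb_eq Fc); exists u.
set a := hilb Z n in sfn ab uE hf ff gf *.
set k := hilb Z (n + d2) in hv fv gv *.
suff : (hilb Z (n + d1 + d2) <= k + (b - a))%N by move: ab; lia.
(* The products of [t] with the first [a] elements of [u] are already multiples of [s], so only the
   last [b - a] are kept. *)
pose W l := if (l < k)%N then s * v l else t * u (a + (l - k))%N.
apply: (@hilb_gen_leq Z _ _ W).
move=> p /hp[f1 [f2 [h1 h2 h3]]].
have h2' : homogeneous (n + d1) f2 by move: h2; rewrite addrK.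
have h1' : homogeneous (n + d2) f1 by move: h1; rewrite addrAC addrK.
have [x vx] := gu _ h2'.
(* The part of [t * f2] divisible by [s] is moved into the multiple of [s]. *)
have : homogeneous (n + d2) (f1 + t * \sum_(l < a) x l *: f l).
  have sH := homogeneous_submodule R c (n + d2).
  apply: (submoduleD sH) => //; rewrite [n + d2]addrC; apply: homogeneousM => //.
  have sH' := homogeneous_submodule R c n.
  by apply: submodule_sum => // l _; apply: (submoduleZ _ sH'); apply: hf.
move=> /gv[y vy].
pose X l := if (l < k)%N then y l else x (a + (l - k))%N.
have XWl (l : 'I_k) : X l *: W l = y l *: (s * v l) by rewrite /X /W ltn_ord.
have XWr (l : 'I_(b - a)) :
    X (k + l)%N *: W (k + l)%N = x (a + l)%N *: (t * u (a + l)%N).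
  by rewrite /X /W ltnNge leq_addr addKn.
exists X; rewrite (big_nat_split _ _ (fun l => X l *: W l)).
rewrite (eq_bigr _ (fun l _ => XWl l)) (eq_bigr _ (fun l _ => XWr l)).
have E1 : \sum_(l < k) y l *: (s * v l) = s * \sum_(l < k) y l *: v l.
  by rewrite mulr_sumr; apply: eq_bigr => l _; rewrite scalerAr.
have E2 : \sum_(l < b - a) x (a + l)%N *: (t * u (a + l)%N) =
    t * \sum_(l < b - a) x (a + l)%N *: u (a + l)%N.
  by rewrite mulr_sumr; apply: eq_bigr => l _; rewrite scalerAr.
have E3 : \sum_(l < b) x l *: u l = s * (\sum_(l < a) x l *: f l) +
    \sum_(l < b - a) x (a + l)%N *: u (a + l)%N.
  have -> : \sum_(l < b) x l *: u l = \sum_(l < a + (b - a)) x l *: u l.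
    by rewrite subnKC.
  rewrite (big_nat_split _ _ (fun l => x l *: u l)); congr (_ + _).
  by rewrite mulr_sumr; apply: eq_bigr => l _; rewrite uE // scalerAr.
rewrite E1 E2; rewrite E3 in vx.
set w1 := \sum_(l < k) _ in vy *; set w2 := \sum_(l < b - a) _ in vx *.
set w3 := \sum_(l < a) _ in vy vx *.
have -> : p - (s * w1 + t * w2) = (p - (s * f1 + t * f2)) +
   (s * (f1 + t * w3 - w1) + t * (f2 - (s * w3 + w2))) by ring.
have sZv := vanishing_submodule Z.
by apply: (submoduleD sZv) => //; apply: (submoduleD sZv); apply: vanishingMl.
Qed.

Definition hcomp n p : S :=
  \sum_(a <- msupp p | mondeg c a == n) p@_a *: 'X_[a].

Lemma mcoeff_hcomp n p a : (hcomp n p)@_a = if mondeg c a == n then p@_a else 0.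
Proof.
rewrite /hcomp raddf_sum /=.
under eq_bigr do rewrite mcoeffZ mcoeffX.
have [ap|ap] := boolP (a \in msupp p); last first.
  rewrite (memN_msupp_eq0 ap) if_same big_seq_cond big1 // => b /andP[bp _].
  by case: eqP => [E|_]; [rewrite -E bp in ap|rewrite mulr0].
rewrite big_mkcond (bigD1_seq a) ?msupp_uniq //= eqxx mulr1.
rewrite big1 ?addr0 // => b /negPf ba; rewrite ba mulr0; by case: ifP.
Qed.

Lemma hcomp_lin n x p q : hcomp n (x *: p + q) = x *: hcomp n p + hcomp n q.
Proof.
apply/mpolyP => a; rewrite mcoeffD mcoeffZ !mcoeff_hcomp mcoeffD mcoeffZ.
by case: ifP => // _; rewrite mulr0 addr0.
Qed.

Lemma hcompE d n p : homogeneous d p -> hcomp n p = if d == n then p else 0.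
Proof.
move=> hp; apply/mpolyP => a; rewrite mcoeff_hcomp.
have [/hp ->|ap] := boolP (a \in msupp p); first by case: ifP; rewrite ?mcoeff0.
by rewrite (memN_msupp_eq0 ap) if_same; case: ifP; rewrite ?mcoeff0 ?(memN_msupp_eq0 ap).
Qed.

Lemma hcompXM n a p : hcomp n ('X_[a] * p) = 'X_[a] * hcomp (n - mondeg c a) p.
Proof.
have h0 m : hcomp m 0 = 0 by rewrite (@hcompE 0) ?if_same // => b; rewrite msupp0.
elim/mpolyind: p => [|x b p _ _ IH]; first by rewrite mulr0 !h0 mulr0.
rewrite mulrDr -scalerAr !hcomp_lin IH mulrDr -scalerAr; congr (_ *: _ + _).
have hX m b' : hcomp m 'X_[b'] = if mondeg c b' == m then 'X_[b'] else 0.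
  by apply: hcompE; apply: homogeneousX.
rewrite -mpolyXD !hX mondegD [_ == n - _]eq_sym subr_eq eq_sym [mondeg c b + _]addrC.
by case: ifP; rewrite ?mpolyXD ?mulr0.
Qed.

End HilbertFunction.

(** * Base-point-free pencils on sets of dimension at most one *)

Section Curves.
Variables (R : realType) (r : nat) (F : fan r (r + r)).
Variable c : 'I_r -> 'I_(r + r) -> nat.
Hypothesis Fc : positive_fan F c.
Local Notation K := R[i].
Local Notation S := {mpoly K[r + r]}.
Local Notation homogeneous := (@homogeneous R r c).
Local Notation hilb := (@hilb R r c).
Implicit Types (i j : 'I_r) (rho : 'I_(r + r)) (e : 'I_r -> bool).
Implicit Types (D : 'rV[int]_(r + r)) (n : 'rV[int]_r) (a b : 'X_{1..r + r}).
Implicit Types (p q f g s t : S) (W Z : set 'rV[K]_(r + r)) (z : 'rV[K]_(r + r)).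

(** Testing every homogeneous component turns the graded condition into an ordinary ideal, to which
    the Nullstellensatz applies. *)
Lemma in_pencil_ideal Z s t d1 d2 :
  ideal [set p : S | forall n, in_pencil c Z s t d1 d2 n (hcomp c n p)].
Proof.
have sP n := in_pencil_submodule c Z s t d1 d2 n.
have J0 n : in_pencil c Z s t d1 d2 n (hcomp c n 0).
  rewrite (@hcompE _ _ c 0) ?if_same; first exact: submodule0.
  by move=> a; rewrite msupp0.
split=> [n|p q hp hq n|f p hp]; [exact: J0| |].
  by rewrite -[p]scale1r hcomp_lin; apply: (sP n).2.
elim/mpolyind: f => [n|x a f _ _ IH n]; first by rewrite mul0r; apply: J0.
rewrite mulrDl -scalerAl hcomp_lin; apply: (sP n).2 => //.
rewrite hcompXM; have [f1 [f2 [h1 h2 h3]]] := hp (n - mondeg c a).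
exists ('X_[a] * f1), ('X_[a] * f2); split.
- have -> : n - d1 = mondeg c a + (n - mondeg c a - d1) by rewrite addrA subrKC.
  by apply: homogeneousM => //; apply: homogeneousX.
- have -> : n - d2 = mondeg c a + (n - mondeg c a - d2) by rewrite addrA subrKC.
  by apply: homogeneousM => //; apply: homogeneousX.
- rewrite [s * _]mulrCA [t * _]mulrCA -mulrDr -mulrBr; exact: vanishingMl.
Qed.

(** For varying [e], these are the generators of the irrelevant ideal. *)
Definition sign_monomial e : 'X_{1..r + r} :=
  [multinom (rho == ray e (position rho) : nat) | rho < r + r].

(** The ideal [J] built from [s], [t] and the equations of [Z] has no zero in [Xhat F], so it
    contains a power of each generator of the irrelevant ideal, and a monomial of large class is
    divisible by one of these powers. *)
Lemma in_pencil_large Z s t d1 d2 : zclosed F Z -> homogeneous d1 s ->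
  homogeneous d2 t ->
  (forall z, Z z -> s.@[z ord0] = 0 -> t.@[z ord0] <> 0) ->
  exists N : nat, forall n, (forall i, N%:Z <= n ord0 i) ->
    forall p, homogeneous n p -> in_pencil c Z s t d1 d2 n p.
Proof.
move=> Zc hs ht st.
pose J : set S := [set p | forall n, in_pencil c Z s t d1 d2 n (hcomp c n p)].
have Ji : ideal J by apply: in_pencil_ideal.
have [_ _ JM] := Ji.
have sP n := in_pencil_submodule c Z s t d1 d2 n.
have h0 m : homogeneous m 0 by move=> a; rewrite msupp0.
have h1 : homogeneous 0 1.
  by move=> a; rewrite -mpolyC1 msuppC oner_eq0 inE => /eqP->; apply: mondeg0.
have v0 : vanishing Z 0 by apply: submodule0 (vanishing_submodule Z).
have Jhom d p : homogeneous d p -> in_pencil c Z s t d1 d2 d p -> J p.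
  move=> hp Pp n; rewrite (hcompE _ hp).
  by case: eqP => [<-//|_]; apply: submodule0.
have JZ d p : homogeneous d p -> vanishing Z p -> J p.
  move=> hp vp; apply: (Jhom d _ hp); exists 0, 0; split; [exact: h0|exact: h0|].
  by rewrite !mulr0 addr0 subr0.
have Js : J s.
  apply: (Jhom d1 _ hs); exists 1, 0.
  split; [by rewrite subrr; exact: h1|exact: h0|].
  by rewrite mulr1 mulr0 addr0 subrr; exact: v0.
have Jt : J t.
  apply: (Jhom d2 _ ht); exists 0, 1.
  split; [exact: h0|by rewrite subrr; exact: h1|].
  by rewrite mulr1 mulr0 add0r subrr; exact: v0.
have /choice[k hk] (e : {ffun 'I_r -> bool}) : exists k, J ('X_[sign_monomial e] ^+ k).
  apply: nullstellensatz => // z' Jz'; apply/eqP; apply: contrapT => /negP.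
  pose z : 'rV[K]_(r + r) := \row_rho z' rho.
  have zE p : p.@[z'] = p.@[z ord0] by apply: meval_eq => rho; rewrite mxE.
  rewrite zE => /meval_monomial_neq0 hz.
  have Xz : Xhat F z.
    apply/(XhatE Fc) => i; have := hz (ray e i).
    rewrite mnmE position_ray eqxx /ray => /(_ isT).
    by case: (e i); [right|left].
  have Zz : Z z.
    have [T [hT EZ]] := (zclosedE Fc Z).1 Zc.
    rewrite EZ; split=> // p Tp; rewrite /zeros /= -zE; apply: Jz'.
    by have [n hn] := hT _ Tp; apply: JZ hn _; rewrite EZ => y [_]; apply.
  by apply: (st z Zz); rewrite -zE; apply: Jz'.
pose k0 := \max_e k e.
have hk0 e : J ('X_[sign_monomial e] ^+ k0).
  have le0 : (k [ffun i => e i] <= k0)%N by apply: leq_bigmax.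
  rewrite -(subnK le0) exprD; apply: JM.
  have -> : sign_monomial e = sign_monomial [ffun i => e i]; last exact: hk.
  by apply/mnmP => rho; rewrite !mnmE /ray ffunE.
exists (k0 + k0)%N => n hn p hp; apply: homogeneous_sum_monomials hp _ => // a an.
pose e i := (k0 <= a (minus i))%N.
have le : (sign_monomial e *+ k0 <= a)%MM.
  apply/mnm_lepP => rho; rewrite mulmnE mnmE.
  case: eqP => [E|_]; last by rewrite mul0n.
  rewrite mul1n E /ray /e; case: (leqP k0 (a (minus (position rho)))) => // lt.
  have := mondeg_sum_ge c a (position rho); rewrite an => /(le_trans (hn _)).
  by rewrite lez_nat; move: lt; lia.
have : J 'X_[a] by rewrite -(submK le) mpolyXD -mpolyXn; apply: JM (hk0 e).
have hX : homogeneous n 'X_[a] by rewrite -an; apply: homogeneousX.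
by move=> /(_ n); rewrite (hcompE _ hX) eqxx.
Qed.

(* The point of the toric variety represented by [z], as the smallest closed
   set containing it. *)
Definition zclosure1 z : set 'rV[K]_(r + r) := [set z' : 'rV[K]_(r + r) | Xhat F z' /\
  forall n p, homogeneous n p -> p.@[z ord0] = 0 -> p.@[z' ord0] = 0].

Lemma zclosure1_closed z : zclosed F (zclosure1 z).
Proof.
apply/(zclosedE Fc).
exists [set p | (exists n, homogeneous n p) /\ p.@[z ord0] = 0]; split; first by move=> p [].
apply/seteqP; split=> z' [Xz' h]; split=> //.
  by move=> p [[n hp] pz]; apply: (h n).
by move=> n p hp pz; apply: (h p); split=> //; exists n.
Qed.

Lemma zclosure1_refl z : Xhat F z -> zclosure1 z z.
Proof. by move=> Xz; split. Qed.

Lemma zclosure1_sub z W : zclosed F W -> W z -> zclosure1 z `<=` W.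
Proof.
move=> /(zclosedE Fc)[T [hT ->]] [_ Tz] z' [Xz' h]; split=> // p Tp.
by have [n hp] := hT _ Tp; apply: h hp _; apply: Tz.
Qed.

Lemma zclosure1_irreducible z : Xhat F z -> zirreducible F (zclosure1 z).
Proof.
move=> Xz; split; first exact: zclosure1_closed.
  by exists z; apply: zclosure1_refl.
move=> Z1 Z2 c1 c2 E; have : (Z1 `|` Z2) z by rewrite -E; apply: zclosure1_refl.
case=> [h|h]; [left|right]; apply/seteqP; split; try exact: zclosure1_sub.
  by rewrite E => y; left.
by rewrite E => y; right.
Qed.

(** Let [p] vanish at [z'], and take [g], [q] of nonnegative classes nonzero at [z], [z']. The
    combination of [q] and [p * g] that vanishes at [z] also vanishes at [z']; so its coefficient on
    [q] is zero, that is, [p] vanishes at [z]. *)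
Lemma zclosure1_sym z z' : Xhat F z -> zclosure1 z z' -> zclosure1 z' z.
Proof.
move=> Xz [Xz' h]; split=> // n p hp pz'.
pose m : 'rV[int]_r := \row_i `|n ord0 i|.
have m0 : nonneg m by move=> i; rewrite mxE normr_ge0.
have nm0 : nonneg (n + m).
  by move=> i; rewrite !mxE; move: (n ord0 i) => x; lia.
have [g hg gz] := ex_section_neq0 Fc m0 Xz.
have [q hq qz'] := ex_section_neq0 Fc nm0 Xz'.
have qz : q.@[z ord0] != 0 by apply/eqP => /(h _ _ hq) E; rewrite E eqxx in qz'.
pose x := (p * g).@[z ord0] / q.@[z ord0].
have : ((- x) *: q + p * g).@[z' ord0] = 0.
  apply: (h (n + m)); first exact: (homogeneous_submodule _ _ _).2 (homogeneousM hp hg).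
  by rewrite mevalD mevalZ mulNr divfK // addNr.
rewrite mevalD mevalZ [in X in _ + X]mevalM pz' mul0r addr0 mulNr => /eqP.
rewrite oppr_eq0 !mulf_eq0 (negPf qz') orbF invr_eq0 (negPf qz) orbF.
by rewrite mevalM mulf_eq0 (negPf gz) orbF => /eqP.
Qed.

Lemma zclosed_separate W z : zclosed F W -> Xhat F z -> ~ W z ->
  exists n p, [/\ homogeneous n p, vanishing W p & p.@[z ord0] != 0].
Proof.
move=> /(zclosedE Fc)[T [hT ->]] Xz nWz; apply: contrapT => nex; apply: nWz.
split=> // p Tp; apply: contrapT => /eqP pz; apply: nex.
have [n hp] := hT _ Tp; exists n, p; split=> // y [_]; exact.
Qed.

Lemma zclosed_sub_Xhat W : zclosed F W -> W `<=` Xhat F.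
Proof. by move=> /(zclosedE Fc)[T [_ ->]] z []. Qed.

(** A descending chain of counterexamples [C k] gives [f k] vanishing on [C k.+1] but not on [C k].
    By [hilbert_basis_seq] some [f k] is a combination of earlier ones, which all vanish on
    [C k]. *)
Lemma zclosed_noetherian (P : set 'rV[K]_(r + r) -> Prop) :
  (forall W, zclosed F W -> (forall W', zclosed F W' -> W' `<` W -> P W') -> P W) ->
  forall W, zclosed F W -> P W.
Proof.
move=> IH W0 W0c; apply: contrapT => nPW0.
pose T := {W | zclosed F W /\ ~ P W}.
have /choice[nxt hnxt] (W : T) : exists W' : T, sval W' `<` sval W.
  apply: contrapT => nW'; have [Wc nPW] := svalP W; apply: nPW; apply: IH => // W' W'c lt.
  apply: contrapT => nPW'; apply: nW'.
  by exists (exist _ W' (conj W'c nPW')).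
pose C k : T := iter k nxt (exist _ W0 (conj W0c nPW0)).
have Cle k l : (k <= l)%N -> sval (C l) `<=` sval (C k).
  elim: l => [|l IHl]; first by case: k => [_ z|].
  rewrite leq_eqVlt => /orP[/eqP-> z //|/IHl]; apply: subset_trans.
  by have [] := hnxt (C l).
have /choice[f hf] k : exists p, vanishing (sval (C k.+1)) p /\ ~ vanishing (sval (C k)) p.
  have [_ /existsNP[z /not_implyP[Cz nCz]]] := hnxt (C k).
  have Xz : Xhat F z by apply: zclosed_sub_Xhat Cz; case: (svalP (C k)).
  have [||n [p [_ vp pz]]] := @zclosed_separate (sval (C k.+1)) z _ Xz.
  - by case: (svalP (C k.+1)).
  - by [].
  by exists p; split=> // /(_ z Cz)/eqP; apply/negP.
have [k [g fk]] := hilbert_basis_seq f.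
apply: (hf k).2; rewrite fk.
apply: (@submodule_sum K S (vanishing (sval (C k)))) => [|l _].
  exact: vanishing_submodule.
apply: vanishingMl.
by move=> z /(Cle _ _ (ltn_ord l)); apply: (hf l).1.
Qed.

(** Noetherian induction: a reducible [W] splits into smaller closed sets, and an irreducible [W]
    larger than a point would be the middle of a chain of length 2 in [Z]. *)
Lemma proper_closed_finite Z W : zirreducible F Z -> ~ dim_ge F Z 2 ->
  zclosed F W -> W `<` Z ->
  exists2 zs : seq 'rV[K]_(r + r), (forall z, z \in zs -> Xhat F z) &
    forall z, W z -> exists2 z0, z0 \in zs & zclosure1 z0 z.
Proof.
move=> Zi Zd Wc; pattern W; move: W Wc; apply: zclosed_noetherian => W Wc IH ltWZ.
have [[z Wz]|W0] := pselect (W !=set0); last first.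
  by exists [::] => // z Wz; case: W0; exists z.
have Xz := zclosed_sub_Xhat Wc Wz.
have [Wi|nWi] := pselect (zirreducible F W).
  exists [:: z]; first by move=> y; rewrite inE => /eqP->.
  move=> y Wy; exists z; first exact: mem_head.
  apply: contrapT => ny; apply: Zd.
  exists (fun k => if k is k'.+1 then if k' is 0 then W else Z else zclosure1 z).
  split=> // [[|[|k]]|[|[|k]]] // _; first exact: zclosure1_irreducible.
  split; first exact: zclosure1_sub.
  by move=> /(_ y Wy).
have [Z1 [Z2 [Z1c Z2c EW [W1 W2]]]] : exists Z1 Z2,
    [/\ zclosed F Z1, zclosed F Z2, W = Z1 `|` Z2 & W <> Z1 /\ W <> Z2].
  apply: contrapT => nex; apply: nWi; split=> //; first by exists z.
  move=> Z1 Z2 Z1c Z2c EW; apply: contrapT => /not_orP h.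
  by apply: nex; exists Z1, Z2.
have sub1 : Z1 `<` W.
  have sub : Z1 `<=` W by rewrite EW => y; left.
  by split=> // h; apply: W1; apply/seteqP; split.
have sub2 : Z2 `<` W.
  have sub : Z2 `<=` W by rewrite EW => y; right.
  by split=> // h; apply: W2; apply/seteqP; split.
have ltZ W' : W' `<` W -> W' `<` Z.
  move=> [h _]; have [h' nh'] := ltWZ.
  by split=> [|h'']; [apply: subset_trans h'|apply: nh'; apply: subset_trans h'' h].
have [zs1 h1 g1] := IH _ Z1c sub1 (ltZ _ sub1).
have [zs2 h2 g2] := IH _ Z2c sub2 (ltZ _ sub2).
exists (zs1 ++ zs2); first by move=> y; rewrite mem_cat => /orP[/h1|/h2].
move=> y; rewrite EW => -[/g1|/g2] [z0 zz0 hz0]; exists z0 => //;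
  by rewrite mem_cat zz0 ?orbT.
Qed.

(** Each point of the list excludes at most one scalar [x] in the combination [x *: t' + t]. *)
Lemma ex_section_avoiding n (zs : seq 'rV[K]_(r + r)) : nonneg n ->
  (forall z, z \in zs -> Xhat F z) ->
  exists2 t, homogeneous n t & forall z, z \in zs -> t.@[z ord0] != 0.
Proof.
move=> n0; elim: zs => [|z zs IH] hz.
  by exists 0 => // a; rewrite msupp0.
have [|t ht tz] := IH; first by move=> y yzs; apply: hz; rewrite inE yzs orbT.
have [t' ht' tz'] := ex_section_neq0 Fc n0 (hz z (mem_head _ _)).
have [x hx] := real_uncountable
  (fun=> [seq complex.Re (- (t.@[y ord0] / t'.@[y ord0])) | y : 'rV[K]_(r+r) <- z :: zs]).
exists (x%:C%C *: t' + t); first exact: (homogeneous_submodule _ _ _).2.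
move=> y yzs; apply/eqP; rewrite mevalD mevalZ => E.
have [t'y|t'y] := eqVneq t'.@[y ord0] 0.
  move: E yzs; rewrite t'y mulr0 add0r => E; rewrite inE => /orP[/eqP yz|/tz].
    by rewrite -yz t'y eqxx in tz'.
  by rewrite E eqxx.
have /negP := hx 0%N; apply; apply/mapP; exists y => //.
have -> : - (t.@[y ord0] / t'.@[y ord0]) = x%:C%C; last by [].
apply: (mulIf t'y); rewrite mulNr divfK //.
by apply/eqP; rewrite eq_sym -addr_eq0 E.
Qed.

(* [Z] has dimension at most 1, so a section not vanishing on [Z] has finitely
   many zeros on [Z], which a second general section avoids. *)
Lemma ex_base_point_free_pencil Z d1 d2 : zirreducible F Z -> ~ dim_ge F Z 2 ->
  nonneg d1 -> nonneg d2 -> exists s t, [/\ homogeneous d1 s, ~ vanishing Z s,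
    homogeneous d2 t & forall z, Z z -> s.@[z ord0] = 0 -> t.@[z ord0] <> 0].
Proof.
move=> Zi Zd d10 d20; have [Zc [z0 Zz0] _] := Zi.
have [s hs sz0] := ex_section_neq0 Fc d10 (zclosed_sub_Xhat Zc Zz0).
have sZ : ~ vanishing Z s by move=> /(_ z0 Zz0)/eqP; apply/negP.
have [||zs hzs gzs] := @proper_closed_finite Z (Z `&` zeros s) Zi Zd.
- exact: (zclosedI_zeros Fc Zc hs).
- split; first by move=> z [].
  by move=> h; apply: sZ => z /h[].
have [t ht tz] := ex_section_avoiding d20 hzs.
exists s, t; split=> // z Zz sz tz0.
have [y yzs hy] := gzs z (conj Zz sz).
have [_ /(_ _ _ ht tz0) E] := zclosure1_sym (hzs _ yzs) hy.
by move: (tz _ yzs); rewrite E eqxx.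
Qed.

End Curves.

(** * Functions on Z^r with nonincreasing increments *)

Section EventuallyLinear.
Variables (r : nat).
Implicit Types (j k : 'I_r) (n A : 'rV[int]_r).

Definition basis_class j : 'rV[int]_r := delta_mx ord0 j.

Lemma basis_class_nonneg j : nonneg (basis_class j).
Proof. by move=> i; rewrite mxE; case: (_ && _). Qed.

Lemma lev_ind A (P : 'rV[int]_r -> Prop) : P A ->
  (forall n k, lev A n -> P n -> P (n + basis_class k)) -> forall n, lev A n -> P n.
Proof.
move=> PA Pstep n; have [d] := ubnP (\sum_i `|n ord0 i - A ord0 i|)%N.
elim: d n => // d IH n ltd An.
have [[k ltk]|nk] := pselect (exists k, A ord0 k < n ord0 k); last first.
  suff -> : n = A by [].
  apply/rowP => k; apply/eqP; rewrite eq_le An andbT leNgt.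
  by apply/negP => lt; apply: nk; exists k.
have E i : (n - basis_class k) ord0 i = n ord0 i - (i == k)%:Z.
  by rewrite !mxE eqxx /=; case: (i == k).
have Ak : lev A (n - basis_class k).
  move=> i; rewrite E; have := An i; have [->|_] := eqVneq i k; last by rewrite subr0.
  by move: ltk; move: (A ord0 k) (n ord0 k) => x y; lia.
rewrite -[n](subrK (basis_class k)); apply: Pstep => //; apply: IH => //.
move: ltd; rewrite !ltnS; apply: leq_trans.
rewrite (bigD1 k) //= [leqRHS](bigD1 k) //= E eqxx -addSn.
apply: leq_add; first by move: ltk; move: (A ord0 k) (n ord0 k) => x y; lia.
by apply: leq_sum => i /negPf ik; rewrite E ik subr0.
Qed.

Lemma mul_basis_class k (m : 'cV[int]_r) : (basis_class k *m m) ord0 ord0 = m k ord0.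
Proof. by rewrite /basis_class -rowE mxE. Qed.

(** The increment in direction [j] is a natural number that does not increase in any direction;
    beyond a point where it is least, it is constant. *)
Lemma eventually_linear (h : 'rV[int]_r -> nat) (N : int) :
  (forall n j, (forall i, N <= n ord0 i) -> (h n <= h (n + basis_class j)%R)%N) ->
  (forall n j k, (forall i, N <= n ord0 i) ->
     (h (n + basis_class j + basis_class k)%R + h n <=
      h (n + basis_class j)%R + h (n + basis_class k)%R)%N) ->
  exists A (m : 'cV[int]_r) (b : int), (forall j, 0 <= m j ord0) /\
    forall n, lev A n -> (h n)%:Z = b + (n *m m) ord0 ord0.
Proof.
move=> hmono hconc.
have /choice[Am hAm] j : exists Am : 'rV[int]_r * nat,
    (forall i, N <= Am.1 ord0 i) /\
    forall n, lev Am.1 n -> (h (n + basis_class j)%R = h n + Am.2)%N.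
  have ex : exists v : nat, `[< exists n, (forall i, N <= n ord0 i) /\
     h (n + basis_class j)%R = (h n + v)%N >].
    exists (h (const_mx N + basis_class j)%R - h (const_mx N))%N; apply/asboolP.
    exists (const_mx N); split; first by move=> i; rewrite mxE.
    by rewrite subnKC // hmono // => i; rewrite mxE.
  case: (ex_minnP ex) => v /asboolP[A [NA Av]] vmin.
  have ge n : lev A n -> forall i, N <= n ord0 i by move=> h1 i; apply: le_trans (h1 i).
  exists (A, v); split=> //= n An.
  have le : (h (n + basis_class j)%R <= h n + v)%N.
    move: n An; apply: lev_ind; first by rewrite Av.
    move=> n k An IH; have := hconc n j k (ge n An).
    have -> : n + basis_class k + basis_class j = n + basis_class j + basis_class k.
      exact: addrAC.
    by move: IH; lia.
  have : (v <= h (n + basis_class j)%R - h n)%N.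
    apply: vmin; apply/asboolP; exists n; split; first exact: ge.
    by rewrite subnKC // hmono //; apply: ge.
  by move: le; have := hmono n j (ge n An); lia.
(* [A] dominates the thresholds of all directions. *)
pose A : 'rV[int]_r := \row_i (\sum_j `|(Am j).1 ord0 i|).
pose m : 'cV[int]_r := \col_j ((Am j).2)%:Z.
exists A, m, ((h A)%:Z - (A *m m) ord0 ord0); split=> [j|]; first by rewrite mxE.
apply: lev_ind => [|n k An IH]; first by rewrite subrK.
have Akn : lev (Am k).1 n.
  move=> i; apply: le_trans (An i); rewrite mxE (bigD1 k) //=.
  apply: le_trans (ler_norm _) _; rewrite lerDl; apply: sumr_ge0 => j _.
  exact: normr_ge0.
rewrite (hAm k).2 // PoszD IH mulmxDl [X in _ = _ + X]mxE mul_basis_class.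
by rewrite [m k ord0]mxE; ring.
Qed.

End EventuallyLinear.

(** * Classes of irreducible curves *)

Section CurveClass.
Variables (R : realType) (r : nat) (F : fan r (r + r)).
Variable c : 'I_r -> 'I_(r + r) -> nat.
Hypothesis Fc : positive_fan F c.
Local Notation K := R[i].

Lemma hilb_eventually_linear (Z : set 'rV[K]_(r + r)) :
  zirreducible F Z -> ~ dim_ge F Z 2 ->
  exists A (m : 'cV[int]_r) (b : int), (forall j, 0 <= m j ord0) /\
    forall n, lev A n -> (hilb c Z n)%:Z = b + (n *m m) ord0 ord0.
Proof.
move=> Zi Zd; have [Zc _ _] := Zi.
have /choice[N hN] (jk : 'I_r * 'I_r) : exists N : nat,
    forall n : 'rV[int]_r, (forall i, N%:Z <= n ord0 i) ->
    (hilb c Z n <= hilb c Z (n + basis_class jk.1))%N /\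
    (hilb c Z (n + basis_class jk.1 + basis_class jk.2) + hilb c Z n <=
     hilb c Z (n + basis_class jk.1) + hilb c Z (n + basis_class jk.2))%N.
  case: jk => j k /=.
  have [s [t [hs sZ ht st]]] := ex_base_point_free_pencil Fc Zi Zd
    (basis_class_nonneg j) (basis_class_nonneg k).
  have [N hN] := in_pencil_large Fc Zc hs ht st.
  exists N => n Nn; split; first by rewrite addrC; apply: (leq_hilb Fc _ Zi hs sZ).
  apply: (hilb_pencil_leq Fc Zi hs sZ ht); apply: hN => i; rewrite !mxE eqxx /=.
  by have := Nn i; move: (n ord0 i) => x; case: (i == j); case: (i == k); lia.
have [||A [m [b [m0 hA]]]] := @eventually_linear r (hilb c Z) (\max_jk N jk)%N%:Z.
- move=> n j ge; apply: (hN (j, j) n _).1 => i; apply: le_trans (ge i).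
  by rewrite lez_nat (leq_bigmax (j, j)).
- move=> n j k ge; apply: (hN (j, k) n _).2 => i; apply: le_trans (ge i).
  by rewrite lez_nat (leq_bigmax (j, k)).
- by exists A, m, b.
Qed.

Lemma curve_class_hilb (Z : set 'rV[K]_(r + r)) A (m : 'cV[int]_r) b :
  (forall n, lev A n -> (hilb c Z n)%:Z = b + (n *m m) ord0 ord0) ->
  curve_class F Z = map_mx intr (relmx c *m m)^T.
Proof.
move=> hA; apply/rowP => rho; rewrite !mxE; congr (_%:~R).
by rewrite (intersection_numberE Fc _ hA) -mulmxA -rowE !mxE.
Qed.

(** The columns of [relmx c] are the primitive relations, and [m j] is the degree on [Z] of the
    divisor class dual to relation [j]. *)
Lemma curve_class_in_cone (Z : set 'rV[K]_(r + r)) : irreducible_curve F Z ->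
  exists m : 'cV[int]_r, (forall j, 0 <= m j ord0) /\
    curve_class F Z = map_mx intr (relmx c *m m)^T.
Proof.
move=> [Zi _ Zd]; have [A [m [b [m0 hA]]]] := hilb_eventually_linear Zi Zd.
by exists m; split=> //; apply: curve_class_hilb hA.
Qed.

End CurveClass.

Lemma ex_nonroot (R : realType) (p : {poly R[i]}) : p != 0 -> exists x, p.[x] != 0.
Proof.
move=> p0; have [s ps] := closed_field_poly_normal p.
have [x hx] := real_uncountable (fun=> map (@complex.Re R) s).
exists x%:C%C; rewrite ps hornerZ mulf_neq0 ?lead_coef_eq0 // horner_prod.
rewrite prodf_seq_neq0; apply/allP => y ys /=.
rewrite hornerXsubC subr_eq0; apply: contra (hx 0%N) => /eqP E.
by apply/mapP; exists y => //; rewrite -E.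
Qed.

(** * Invariant lines *)

Section FixedLine.
Variables (R : realType) (r : nat) (F : fan r (r + r)).
Variable c : 'I_r -> 'I_(r + r) -> nat.
Hypothesis Fc : positive_fan F c.
Variables (i : 'I_r) (e : 'I_r -> bool).
Hypothesis rel_e : forall rho, c i rho != 0%N -> rho = ray e (position rho).
Local Notation K := R[i].
Local Notation S := {mpoly K[r + r]}.
Local Notation homogeneous := (@homogeneous R r c).
Local Notation hilb := (@hilb R r c).
Implicit Types (j : 'I_r) (rho : 'I_(r + r)) (x : K).
Implicit Types (n : 'rV[int]_r) (a b : 'X_{1..r + r}).
Implicit Types (p q g : S) (W Z : set 'rV[K]_(r + r)) (z : 'rV[K]_(r + r)).

(* The curve of the wall [tau = {ray e j, j != i}]; by [rel_e], [tau] contains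
   the cone of the primitive relation of [i]. *)
Definition fixed_line : set 'rV[K]_(r + r) :=
  [set z : 'rV[K]_(r + r) | Xhat F z /\ forall j, j != i -> z ord0 (ray e j) = 0].

(** Affine coordinate on the line, in the chart where all opposite coordinates are 1. *)
Definition line_point x : 'rV[K]_(r + r) := \row_rho
  (if rho == ray e (position rho) then (if position rho == i then x else 0) else 1).

(* Monomials that do not vanish identically on the line. *)
Definition off_wall a := [forall j : 'I_r, (j != i) ==> (a (ray e j) == 0%N)].

Definition line_poly p : {poly K} :=
  \sum_(a <- msupp p | off_wall a) p@_a *: 'X^(a (ray e i)).

Lemma line_point_ray x j : line_point x ord0 (ray e j) = if j == i then x else 0.
Proof. by rewrite mxE position_ray eqxx. Qed.

Lemma line_point_opposite x j : line_point x ord0 (ray (negb \o e) j) = 1.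
Proof. by rewrite mxE position_ray eq_sym ray_neq_opposite. Qed.

Lemma line_point_in x : fixed_line (line_point x).
Proof.
split=> [|j /negPf ji]; last by rewrite line_point_ray ji.
apply/(XhatE Fc) => j; have := line_point_opposite x j; rewrite /ray /=.
by case: (e j) => /= ->; [left|right]; apply: oner_neq0.
Qed.

Lemma meval_line_point a x :
  ('X_[a] : S).@[line_point x ord0] = if off_wall a then x ^+ a (ray e i) else 0.
Proof.
rewrite mevalX; case: ifPn => [/forallP h|].
  rewrite (bigD1 (ray e i)) //= line_point_ray eqxx big1 ?mulr1 // => rho rhoi.
  case: (ray_or_opposite e rho) => E; last by rewrite E line_point_opposite expr1n.
  have ji : position rho != i by apply: contra rhoi => /eqP <-; rewrite -E.
  by have := h (position rho); rewrite ji -E => /eqP ->; rewrite expr0.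
rewrite negb_forall => /existsP[j]; rewrite negb_imply => /andP[ji aj].
by rewrite (bigD1 (ray e j)) //= line_point_ray (negPf ji) expr0n (negPf aj) mul0r.
Qed.

Lemma line_polyE p x : (line_poly p).[x] = p.@[line_point x ord0].
Proof.
rewrite [in RHS](mpolyE p) raddf_sum /= /line_poly horner_sum big_mkcond /=.
apply: eq_bigr => a _; rewrite mevalZ meval_line_point.
by case: ifP => _; rewrite ?mulr0 // hornerZ hornerXn.
Qed.

Lemma meval_on_wall a z : fixed_line z -> ~~ off_wall a -> ('X_[a] : S).@[z ord0] = 0.
Proof.
move=> [_ h]; rewrite negb_forall => /existsP[j]; rewrite negb_imply => /andP[ji aj].
by rewrite mevalX (bigD1 (ray e j)) //= h // expr0n (negPf aj) mul0r.
Qed.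

Lemma off_wall_inj n a b : mondeg c a = n -> mondeg c b = n -> off_wall a ->
  off_wall b -> a (ray e i) = b (ray e i) -> a = b.
Proof.
move=> an bn /forallP ha /forallP hb E.
apply: (@mondeg_inj _ _ (relation_gt Fc) e); first by rewrite an bn.
move=> j; have [->//|ji] := eqVneq j i.
by have := ha j; have := hb j; rewrite ji => /eqP -> /eqP ->.
Qed.

(** Off-wall monomials of one class differ in the exponent of [ray e i], so restriction to the chart
    causes no cancellation. *)
Lemma line_poly_eq0 n p : homogeneous n p -> line_poly p = 0 ->
  vanishing fixed_line p.
Proof.
move=> hp p0 z Lz; rewrite /zeros /= (mpolyE p) raddf_sum /= big_seq big1 // => a pa.
rewrite mevalZ; have [aw|aw] := boolP (off_wall a); last first.
  by rewrite meval_on_wall // mulr0.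
suff -> : p@_a = 0 by rewrite mul0r.
have := congr1 (fun u : {poly K} => u`_(a (ray e i))) p0.
rewrite coef0 /line_poly coef_sum big_mkcond (bigD1_seq a) ?msupp_uniq //= aw.
rewrite coefZ coefXn eqxx mulr1 big_seq_cond big1 ?addr0 //= => b /andP[pb ba].
case: ifP => // bw; rewrite coefZ coefXn; case: eqP => [E|_]; last by rewrite mulr0.
by move: ba; rewrite (off_wall_inj (hp _ pa) (hp _ pb) aw bw E) eqxx.
Qed.

Lemma fixed_line_closed : zclosed F fixed_line.
Proof.
apply/(zclosedE Fc).
exists [set p | exists2 j, j != i & p = 'X_(ray e j)]; split.
  by move=> _ [j _ ->]; exists (mondeg c U_(ray e j)); apply: homogeneousX.
apply/seteqP; split=> z [Xz h]; split=> //.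
  by move=> _ [j ji ->]; rewrite /zeros /= mevalXU h.
by move=> j ji; have := h 'X_(ray e j); rewrite /zeros /= mevalXU; apply; exists j.
Qed.

(** Two proper closed pieces would give two nonzero polynomials in one variable; at a parameter
    where neither vanishes, the point lies in no piece. *)
Lemma fixed_line_irreducible : zirreducible F fixed_line.
Proof.
split; first exact: fixed_line_closed.
  by exists (line_point 0); apply: line_point_in.
move=> Z1 Z2 c1 c2 E; apply: contrapT => /not_orP[ne1 ne2].
have sep Z : zclosed F Z -> Z `<=` fixed_line -> fixed_line <> Z ->
    exists p, vanishing Z p /\ line_poly p != 0.
  move=> Zc sub ne; have [z [Lz nZz]] : exists z, fixed_line z /\ ~ Z z.
    apply: contrapT => nex; apply: ne; apply/seteqP; split=> // z Lz.
    by apply: contrapT => nZz; apply: nex; exists z.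
  have [n [p [hp vp pz]]] := zclosed_separate Fc Zc Lz.1 nZz.
  exists p; split=> //; apply/eqP => /(line_poly_eq0 hp)/(_ z Lz)/eqP.
  by apply/negP.
have [|p [vp p0]] := sep Z1 c1 _ ne1; first by rewrite E => z; left.
have [|q [vq q0]] := sep Z2 c2 _ ne2; first by rewrite E => z; right.
have [x] := ex_nonroot (mulf_neq0 p0 q0).
rewrite hornerM !line_polyE mulf_eq0 negb_or => /andP[/eqP px /eqP qx].
by have := line_point_in x; rewrite E => -[/vp|/vq].
Qed.

(** By [rel_e] the rays of relation [i] lie in the wall, so the negative term of class coordinate
    [i] vanishes on off-wall monomials. *)
Lemma off_wall_le n a : mondeg c a = n -> off_wall a ->
  (a (ray e i))%:Z <= n ord0 i.
Proof.
move=> <- /forallP aw; rewrite (mondegE _ e) big1 ?subr0 ?lez_nat ?leq_addr //.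
move=> rho _; have [->|ci] := eqVneq (c i rho) 0%N; first by rewrite muln0.
have ji : position rho != i.
  by apply: contraTneq (relation_gt Fc ci) => ->; rewrite ltnn.
by have := aw (position rho); rewrite ji -(rel_e ci) => /eqP ->.
Qed.

(** As for binary forms on the projective line, there is one basis monomial for each exponent of
    [ray e i] between 0 and coordinate [i] of [n]. *)
Lemma hilb_fixed_line n : nonneg n -> (hilb fixed_line n)%:Z = 1 + n ord0 i.
Proof.
move=> n0; pose d := `|n ord0 i|%N.
have dE : d%:Z = n ord0 i by rewrite /d; have := n0 i; move: (n ord0 i) => x; lia.
suff -> : hilb fixed_line n = d.+1 by rewrite -dE; lia.
apply: (hilb_eq Fc).
have /choice[m hm] (k : nat) : exists a, (k < d.+1)%N ->
    [/\ mondeg c a = n, off_wall a & a (ray e i) = k].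
  have [kd|] := ltnP k d.+1; last by exists 0%MM.
  have [|a an ae] := ex_mondeg (relation_gt Fc) e (n := n)
    (v := fun j => if j == i then k else 0%N).
    move=> j; case: eqP => [->|_]; last exact: n0.
    by rewrite -dE lez_nat -ltnS.
  exists a => _; split=> //; last by rewrite ae eqxx.
  by apply/forallP => j; apply/implyP => /negPf ji; rewrite ae ji.
exists (fun k => 'X_[m k]); split.
- by move=> k kd; have [<- _ _] := hm k kd; apply: homogeneousX.
- move=> x vx k kd; pose P : {poly K} := \poly_(l < d.+1) x l.
  have P0 : P = 0.
    apply/eqP; apply: contrapT => /negP/ex_nonroot[y]; apply/negP; rewrite negbK.
    rewrite /P horner_poly; have := vx _ (line_point_in y); rewrite /zeros /=.
    rewrite raddf_sum /= => E; rewrite -[X in _ == X]E; apply/eqP; apply: eq_bigr => l _.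
    by have [_ lw la] := hm l (ltn_ord l); rewrite mevalZ meval_line_point lw la.
  by have := congr1 (fun u : {poly K} => u`_k) P0; rewrite coef0 coef_poly kd.
- move=> p hp; pose J q := exists y : nat -> K,
    vanishing fixed_line (q - \sum_(k < d.+1) y k *: 'X_[m k]).
  have sV := vanishing_submodule fixed_line.
  apply: (@homogeneous_sum_monomials R r c J n) => //.
    split.
      exists (fun=> 0); rewrite big1 ?subr0; first exact: submodule0 sV.
      by move=> k _; rewrite scale0r.
    move=> y q q' [u hu] [u' hu']; exists (fun k => y * u k + u' k).
    under eq_bigr do rewrite scalerDl -scalerA.
    rewrite big_split /= -scaler_sumr opprD addrACA -scalerBr.
    exact: sV.2.
  move=> a an; have [aw|aw] := boolP (off_wall a); last first.
    exists (fun=> 0); rewrite big1 ?subr0 => [z Lz|k _]; last by rewrite scale0r.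
    exact: meval_on_wall.
  have := off_wall_le an aw; rewrite -dE lez_nat -ltnS => ad.
  exists (fun k => (k == a (ray e i))%:R).
  rewrite (bigD1 (Ordinal ad)) //= eqxx scale1r big1 => [|k].
    have [h1 h2 h3] := hm _ ad.
    rewrite addr0 (off_wall_inj an h1 aw h2) ?h3 // subrr; exact: submodule0 sV.
  by rewrite -val_eqE /= => /negPf ->; rewrite scale0r.
Qed.

Lemma curve_class_fixed_line : curve_class F fixed_line = map_mx intr (col i (relmx c))^T.
Proof.
rewrite (@curve_class_hilb _ _ _ _ Fc _ 0 (delta_mx i ord0) 1); first by rewrite -colE.
move=> n n0; rewrite hilb_fixed_line; last by move=> j; have := n0 j; rewrite mxE.
by rewrite -colE mxE.
Qed.

(** A family free on [W] stays free on [Z] together with the products [p * v], since these vanish on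
    [W]. *)
Lemma hilb_proper_leq Z W n d p : zirreducible F Z -> W `<=` Z ->
  homogeneous d p -> vanishing W p -> ~ vanishing Z p ->
  (hilb W (d + n) + hilb Z n <= hilb Z (d + n))%N.
Proof.
move=> Zi WZ hp vp pZ.
have [u [hu fu _]] := hilbP Fc W (d + n); have [v [hv fv _]] := hilbP Fc Z n.
set k := hilb W (d + n) in hu fu *; set l := hilb Z n in hv fv *.
pose w t := if (t < k)%N then u t else p * v (t - k)%N.
apply: (@hilb_free_leq _ _ _ _ Fc _ _ _ w).
  move=> t tkl; rewrite /w; case: ltnP => [/hu//|kt].
  by apply: homogeneousM => //; apply: hv; rewrite ltn_subLR.
move=> x; rewrite (big_nat_split _ _ (fun t => x t *: w t)).
have wl (t : 'I_k) : x t *: w t = x t *: u t by rewrite /w ltn_ord.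
have wr (t : 'I_l) : x (k + t)%N *: w (k + t)%N = x (k + t)%N *: (p * v t).
  by rewrite /w ltnNge leq_addr addKn.
rewrite (eq_bigr _ (fun t _ => wl t)) (eq_bigr _ (fun t _ => wr t)) => vx.
have pv := free_mul Fc Zi hp pZ hv fv.
have xk t : (t < k)%N -> x t = 0.
  apply: fu => z Wz; have := vx z (WZ z Wz); rewrite /zeros /= mevalD.
  rewrite [X in _ + X]raddf_sum /= [X in _ + X]big1 ?addr0 // => b _.
  by rewrite mevalZ mevalM (vp z Wz) mul0r mulr0.
move: vx; rewrite big1 => [|t _]; last by rewrite xk ?scale0r.
rewrite add0r => vx t tkl; have [/xk//|kt] := ltnP t k.
rewrite -(subnKC kt); apply: (pv (fun t => x (k + t)%N)) => //.
by rewrite ltn_subLR.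
Qed.

Lemma ex_separating Z W : zclosed F W -> zclosed F Z -> W `<` Z ->
  exists n p, [/\ homogeneous n p, vanishing W p, ~ vanishing Z p & nonneg n].
Proof.
move=> Wc Zc [_ /existsNP[z /not_implyP[Zz nWz]]].
have Xz := zclosed_sub_Xhat Fc Zc Zz.
have [n [p [hp vp pz]]] := zclosed_separate Fc Wc Xz nWz.
pose m : 'rV[int]_r := \row_j `|n ord0 j|.
have [|g hg gz] := @ex_section_neq0 R _ _ _ Fc m z _ Xz.
  by move=> j; rewrite mxE normr_ge0.
exists (n + m), (p * g); split; first exact: homogeneousM.
- exact: vanishingMr.
- by move=> /(_ z Zz); rewrite /zeros /= mevalM => /eqP; rewrite mulf_eq0 (negPf pz) (negPf gz).
- by move=> j; rewrite !mxE; move: (n ord0 j) => x; lia.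
Qed.

Lemma hilb_gt0 W n : W `<=` Xhat F -> W !=set0 -> nonneg n -> (0 < hilb W n)%N.
Proof.
move=> WX [z Wz] n0; have [p hp pz] := ex_section_neq0 Fc n0 (WX _ Wz).
apply: (@hilb_free_leq _ _ _ _ Fc _ _ 1 (fun=> p)) => // x.
rewrite big_ord1 => /(_ z Wz); rewrite /zeros /= mevalZ => /eqP.
by rewrite mulf_eq0 (negPf pz) orbF => /eqP x0 [].
Qed.

(* The Hilbert function of a proper closed subset of the line is bounded, that
   of an irreducible set which is not a point is not. *)
Lemma fixed_line_dim : ~ dim_ge F fixed_line 2.
Proof.
move=> [C [C2 Ci Clt]].
have Cc k : (k <= 2)%N -> zclosed F (C k) by move=> /Ci[].
have [d1 [p [hp vp pL d10]]] := ex_separating (Cc 1%N isT) (Cc 2%N isT) (Clt 1%N isT).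
have [d2 [q [hq vq qZ d20]]] := ex_separating (Cc 0%N isT) (Cc 1%N isT) (Clt 0%N isT).
have [sub01 _] := Clt 0%N isT; have [sub12 _] := Clt 1%N isT.
pose n k : 'rV[int]_r := d2 *+ k.
have n0 k : nonneg (d1 + n k) /\ nonneg (n k).
  elim: k => [|k [IH1 IH2]]; first by rewrite /n mulr0n addr0; split=> // j; rewrite mxE.
  rewrite /n mulrSr addrA; split=> j; rewrite mxE.
    by have := IH1 j; have := d20 j; rewrite /n => h1 h2; apply: addr_ge0.
  by have := IH2 j; have := d20 j; rewrite /n => h1 h2; apply: addr_ge0.
(* Each step by [d2] adds at least the Hilbert value of the nonempty [C 0]. *)
have lo k : (k <= hilb (C 1%N) (d1 + n k))%N.
  elim: k => // k IH.
  have := @hilb_proper_leq (C 1%N) (C 0%N) (d1 + n k) d2 q (Ci 1%N isT) sub01 hq vq qZ.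
  have -> : d2 + (d1 + n k) = d1 + n k.+1 by rewrite /n mulrS addrCA.
  apply: leq_trans; rewrite -add1n; apply: leq_add => //.
  apply: hilb_gt0; last by case: (n0 k.+1).
    exact: (zclosed_sub_Xhat Fc (Cc 0%N isT)).
  by have [] := Ci 0%N isT.
(* The Hilbert function of the line is affine, so its increment by [d1] does not depend on [k]. *)
have hi k : (hilb (C 1%N) (d1 + n k) <= `|d1 ord0 i|)%N.
  have := @hilb_proper_leq (C 2) (C 1%N) (n k) d1 p (Ci 2%N isT) sub12 hp vp pL.
  rewrite C2; have := hilb_fixed_line (n0 k).2; have := hilb_fixed_line (n0 k).1.
  rewrite [X in _ = 1 + X -> _]mxE; move: (hilb _ _) (hilb _ _) (hilb _ _) => h1 h2 h3.
  by move: (n k ord0 i) (d1 ord0 i) => x y; lia.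
by have := leq_trans (lo (`|d1 ord0 i|.+1)%N) (hi _); rewrite ltnn.
Qed.

Lemma fixed_line_curve : irreducible_curve F fixed_line.
Proof.
split; [exact: fixed_line_irreducible| |exact: fixed_line_dim].
have L0 := line_point_in 0; have X0 := L0.1.
exists (fun k => if k is 0 then zclosure1 F c (line_point 0) else fixed_line).
split=> // [[|k] _|[|k] _//]; [exact: (zclosure1_irreducible Fc)|exact: fixed_line_irreducible|].
split; first exact: (zclosure1_sub Fc fixed_line_closed).
have hX : homogeneous (mondeg c U_(ray e i)) 'X_(ray e i) by apply: homogeneousX.
move=> /(_ _ (line_point_in 1))[_ /(_ _ _ hX)]; rewrite !mevalXU !line_point_ray eqxx.
by move=> /(_ erefl)/eqP; rewrite oner_eq0.
Qed.

End FixedLine.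

(** * Primitive relations of the toric limit *)

Section ToricLimitRelations.
Variables (G : kac_moody) (w : seq (simple G)).
Local Notation beta := (beta w).
Implicit Types (j l t : nat) (a : nat -> int).

(* Expansion of [\sum_(l > j) a l e_l] on the rays, position by position: the
   coefficients left after the positions [j + 1, ..., j + t]. *)
Fixpoint remainder j a t : nat -> int :=
  if t is t'.+1 then
    let a' := remainder j a t' in
    let l := (j + t').+1 in
    if a' l < 0 then fun l' => - a' l * beta l l' + a' l' else a'
  else a.

(** The value at [l] when position [l] is about to be treated: if positive, the coefficient of
    e_l^+; if negative, minus that of e_l^-. *)
Definition coefficient j a l : int := remainder j a (l - j.+1) l.

Lemma remainderD j a t t' :
  remainder j a (t + t') = remainder (j + t) (remainder j a t) t'.
Proof. by elim: t' => [|t' IH]; rewrite ?addn0 // addnS /= IH addnA. Qed.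

Lemma remainder_id j a t : (forall l, (j < l <= j + t)%N -> 0 <= a l) ->
  remainder j a t = a.
Proof.
elim: t => //= t IH a0; rewrite IH; last by move=> l h; apply: a0; lia.
by rewrite ltNge a0 //; lia.
Qed.

Lemma remainder_sum j a t l : remainder j a t l = a l +
  \sum_(s < t) Num.max 0 (- coefficient j a (j + s).+1) * beta (j + s).+1 l.
Proof.
elim: t => [|t IH]; first by rewrite big_ord0 addr0.
rewrite big_ord_recr /= {2}/coefficient subSS addKn addrA -IH.
case: ltP => [lt|ge].
  by rewrite (max_idPr _); [exact: addrC|lia].
by rewrite (max_idPl _) ?mul0r ?addr0 //; lia.
Qed.

Lemma filter_iota_head (P : pred nat) m n x s : [seq l <- iota m n | P l] = x :: s ->
  [/\ (m <= x < m + n)%N, P x & forall y, (m <= y < x)%N -> ~~ P y].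
Proof.
elim: n m => //= n IH m; case: ifP => [Pm [<- _]|Pm /IH[h1 h2 h3]].
  by split=> //; [lia|move=> y; lia].
split=> //; first lia.
move=> y h; have [->|ne] := eqVneq y m; first by rewrite Pm.
by apply: h3; lia.
Qed.

(** Up to the next index no coefficient is negative and the remainder does not change; at that index
    both recursions make the same update. *)
Lemma mem_index_steps fuel j a l : (size w <= fuel + j)%N ->
  (l \in index_steps w fuel j a) = [&& (j < l)%N, (l < size w)%N & coefficient j a l < 0].
Proof.
elim: fuel j a => [|fuel IH] j a hf.
  by rewrite in_nil; apply/esym/negP => /and3P[]; lia.
rewrite /=; case E : [seq _ <- _ | _] => [|j' s].
  rewrite in_nil; apply/esym/negP => /and3P[jl lw].
  have h y : (j < y < size w)%N -> 0 <= a y.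
    move=> hy; rewrite leNgt; apply/negP => ay.
    have : y \in [seq l <- positions_after w j | a l < 0].
      by rewrite mem_filter ay /positions_after mem_iota; lia.
    by rewrite E in_nil.
  rewrite /coefficient remainder_id => [|y hy]; last by apply: h; lia.
  by rewrite ltNge h //; lia.
have [h1 h2 h3] := filter_iota_head E.
have a0 y : (j < y < j')%N -> 0 <= a y.
  by move=> hy; rewrite leNgt; apply: h3; lia.
rewrite inE IH; last by lia.
have Ea : remainder j a (j' - j.+1) = a by apply: remainder_id => y hy; apply: a0; lia.
have ESj : remainder j a (j' - j) = fun l => - a j' * beta j' l + a l.
  have -> : (j' - j = (j' - j.+1).+1)%N by lia.
  rewrite /= Ea; have -> : (j + (j' - j.+1)).+1 = j' by lia.
  by rewrite h2.
have [ll|ll|ll] := ltngtP l j'.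
- rewrite /=; apply/esym/negP => /and3P[h4 h5].
  rewrite /coefficient remainder_id => [|y hy]; last by apply: a0; lia.
  by rewrite ltNge a0 //; lia.
- rewrite /=; have -> : (j < l)%N by lia.
  have -> : coefficient j a l = coefficient j' (fun l => - a j' * beta j' l + a l) l.
    rewrite /coefficient; have -> : (l - j.+1 = (j' - j) + (l - j'.+1))%N by lia.
    by rewrite remainderD ESj; have -> : (j + (j' - j) = j')%N by lia.
  by [].
- subst l; apply/esym/and3P; split; [lia|lia|].
  rewrite /coefficient remainder_id; last by move=> y hy; apply: a0; lia.
  by [].
Qed.

(** The start is [- beta i l] because e_i^+ + e_i^- is minus the sum of the beta_il e_l over l >
    i. *)
Definition relation_coefficient i l : int := coefficient i (fun l => - beta i l) l.

Lemma mem_index_set i l : (l \in index_set w i) = (l == i) ||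
  [&& (i < l)%N, (l < size w)%N & relation_coefficient i l < 0].
Proof.
(* The special first step of [index_set] is a general step for [- beta i l], with the sign
   unfolded. *)
have -> : index_set w i = i :: index_steps w (size w).+1 i (fun l => - beta i l).
  rewrite /index_set /=.
  under [in RHS]eq_filter do rewrite oppr_lt0.
  case: [seq _ <- _ | _] => // j' s; congr (_ :: (_ :: _)).
  by congr (index_steps _ _ _ _); apply/funext => l'; rewrite opprK.
by rewrite inE mem_index_steps //; lia.
Qed.

Section Prefix.
Variable k : nat.
Implicit Types (i : 'I_k) (rho : 'I_(k + k)).

Definition primitive_coefficient i rho : nat :=
  let x := relation_coefficient i (position rho) in
  if (i < position rho)%N then
    if rho == plus (position rho) then if 0 < x then `|x|%N else 0%N
    else if x < 0 then `|x|%N else 0%N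
  else 0%N.

Lemma primitive_coefficient_plus i (l : 'I_k) : primitive_coefficient i (plus l) =
  if (i < l)%N && (0 < relation_coefficient i l) then `|relation_coefficient i l|%N else 0%N.
Proof. by rewrite /primitive_coefficient position_plus eqxx; case: (i < l)%N. Qed.

Lemma primitive_coefficient_minus i (l : 'I_k) : primitive_coefficient i (minus l) =
  if (i < l)%N && (relation_coefficient i l < 0) then `|relation_coefficient i l|%N else 0%N.
Proof.
rewrite /primitive_coefficient position_minus eq_sym plus_neq_minus.
by case: (i < l)%N.
Qed.

Lemma rays_plus (i l : 'I_k) : rays (toric_limit w k) (plus i) l = (i == l)%:R.
Proof. by rewrite /= col_mxEu mxE. Qed.

Lemma rays_minus (i l : 'I_k) :
  rays (toric_limit w k) (minus i) l = - (i == l)%:R - (i < l)%N%:R * beta i l.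
Proof. by rewrite /= col_mxEd mxE. Qed.

Lemma sum_nat_between i (l : 'I_k) (f : nat -> int) :
  \sum_(h < k | (i < h < l)%N) f h = \sum_(s < l - i.+1) f (i + s).+1.
Proof.
rewrite -(big_mkord (fun h => (i < h < l)%N)).
rewrite (big_cat_nat_idem _ (n := l)) //=; last exact: ltnW.
rewrite [X in _ + X]big_nat_cond [X in _ + X]big_pred0 ?addr0 => [|h]; last by lia.
have [il|li] := ltnP i l; last first.
  rewrite big_nat_cond big_pred0 => [|h]; last by lia.
  have -> : (l - i.+1 = 0)%N by lia.
  by rewrite big_ord0.
rewrite (big_cat_nat_idem _ (n := i.+1)) //=.
rewrite [X in X + _]big_nat_cond [X in X + _]big_pred0 ?add0r => [|h]; last by lia.
rewrite -[i.+1]add0n big_addn big_mkord.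
apply: eq_big => [s|s _]; first by have := ltn_ord s; lia.
by rewrite addnS addnC.
Qed.

(** At coordinate [l] the rays [minus h] with [i < h < l] contribute, up to sign, the correction sum
    of [remainder_sum]. *)
Lemma primitive_relation_rays i (l : 'I_k) :
  \sum_rho (primitive_coefficient i rho)%:Z * rays (toric_limit w k) rho l =
  rays (toric_limit w k) (plus i) l + rays (toric_limit w k) (minus i) l.
Proof.
have delta (f : 'I_k -> int) : \sum_h f h * (h == l)%:R = f l.
  rewrite (bigD1 l) //= eqxx mulr1 big1 ?addr0 // => h /negPf ->.
  by rewrite mulr0.
rewrite (sum_rays (fun=> false)) /ray /= big_split /=.
under eq_bigr do rewrite rays_plus.
under [X in _ + X]eq_bigr do rewrite rays_minus mulrBr mulrN.
rewrite sumrB sumrN !delta rays_plus rays_minus.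
have -> : \sum_h (primitive_coefficient i (minus h))%:Z * ((h < l)%N%:R * beta h l) =
    \sum_(h < k | (i < h < l)%N) Num.max 0 (- relation_coefficient i h) * beta h l.
  rewrite [RHS]big_mkcond; apply: eq_bigr => h _; rewrite primitive_coefficient_minus.
  case: (i < h)%N => /=; last by rewrite mul0r.
  case: (h < l)%N; last by rewrite mul0r mulr0.
  rewrite mul1r; congr (_ * _); case: (ltP (relation_coefficient i h) 0) => hx; first lia.
  by rewrite (max_idPl _) //; lia.
rewrite (sum_nat_between i l (fun h => Num.max 0 (- relation_coefficient i h) * beta h l)).
rewrite primitive_coefficient_plus primitive_coefficient_minus.
case: (ltnP i l) => [il|li] /=; last first.
  have -> : (l - i.+1 = 0)%N by lia.
  by rewrite big_ord0; ring.
have := remainder_sum i (fun l => - beta i l) (l - i.+1) l.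
rewrite -[remainder _ _ _ _]/(relation_coefficient i l).
rewrite -[\sum_(s < _) _]/(\sum_(s < l - i.+1)
   Num.max 0 (- relation_coefficient i (i + s).+1) * beta (i + s).+1 l).
move: (\sum_(s < _) _) (relation_coefficient i l) => S x E.
case: (ltgtP 0 x) => hx; rewrite ?mul1r; move: E hx; lia.
Qed.

Lemma toric_limit_positive_fan : positive_fan (toric_limit w k) primitive_coefficient.
Proof.
have c_gt (i : 'I_k) rho : primitive_coefficient i rho != 0%N -> (i < position rho)%N.
  by rewrite /primitive_coefficient; case: ltnP.
have rel : (rays (toric_limit w k))^T *m relmx primitive_coefficient = 0.
  apply/matrixP => l i; rewrite -[LHS]mulr1 mxE [RHS]mxE mulr1.
  under eq_bigr do rewrite [_^T _ _]mxE [relmx _ _ _]mxE mulrBr.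
  rewrite sumrB (sum_rays (fun=> false)) (bigD1 i) //= big1 => [|h /negPf hi].
    rewrite /ray /= position_plus position_minus eqxx !mulr1 addr0.
    rewrite -primitive_relation_rays; apply/eqP; rewrite subr_eq0; apply/eqP.
    by apply: eq_bigr => rho _; rewrite mulrC.
  by rewrite /ray /= position_plus position_minus hi !mulr0 addr0.
split=> //.
- move=> i j; rewrite primitive_coefficient_plus primitive_coefficient_minus.
  by case: ltgtP; rewrite ?andbF; auto.
- move=> D D'; split=> [[chi ->]|E].
    by rewrite mulmxDl -mulmxA rel mulmx0 addr0.
  (* The rays [plus l] form the standard basis, so the character is read off there; [relmx_mul_inj]
     settles the other rays. *)
  exists (\row_l (D' - D) ord0 (plus l)); set chi := \row_l _.
  apply/eqP; rewrite addrC -subr_eq -subr_eq0; apply/eqP.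
  apply: (relmx_mul_inj c_gt (e := fun=> false)).
    by rewrite mulmxBl -mulmxA rel mulmx0 subr0 mulmxBl E subrr.
  move=> l; rewrite /ray /= [X in X = _]mxE [X in _ + X]mxE [X in _ - X]mxE.
  rewrite (bigD1 l) //= big1 => [|h hl].
    by rewrite [chi _ _]mxE [_^T _ _]mxE rays_plus eqxx mulr1 addr0 subrr.
  by rewrite [_^T _ _]mxE rays_plus eq_sym (negPf hl) mulr0.
- by move=> sigma; rewrite inE.
Qed.

End Prefix.

(** The purpose of the index set: its sign vector meets the hypothesis [rel_e] on invariant
    lines. *)
Lemma index_set_ray (i : 'I_(size w)) rho : primitive_coefficient i rho != 0%N ->
  rho = ray (fun j : 'I_(size w) => (j : nat) \in index_set w i) (position rho).
Proof.
rewrite /ray mem_index_set ltn_ord /=.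
case: (plus_or_minus rho) => E; rewrite E ?position_plus ?position_minus.
  rewrite primitive_coefficient_plus; case: ltnP => //= il.
  by rewrite (gtn_eqF il) /=; case: ltgtP.
rewrite primitive_coefficient_minus; case: ltnP => //= il.
by rewrite (gtn_eqF il) /=; case: ltgtP.
Qed.

(** * The curve of the index set as an invariant line *)

Variable R : realType.

(** Each section adds one vanishing coordinate, with sign given by membership in [I]. Positions
    below [i] are not in [I], in agreement with the [plus] coordinates that vanish at the Schubert
    point. *)
Lemma lift_lineE (i : nat) (I : seq nat) k : (forall j, j \in I -> (i <= j)%N) ->
  (i < k)%N -> forall z : 'rV[R[i]]_(k + k), @lift_line R G w i I k z <->
    Xhat (toric_limit w k) z /\ forall j : 'I_k, (j : nat) != i ->
      z ord0 (ray (fun j : 'I_k => (j : nat) \in I) j) = 0.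
Proof.
move=> Ii; elim: k => // k IH ik.
have XE l := XhatE (R := R) (toric_limit_positive_fan l).
have projE (z : 'rV[R[i]]_(k.+1 + k.+1)) (e : nat -> bool) (j : 'I_k) :
    proj z ord0 (ray (fun j : 'I_k => e j) j) =
    z ord0 (ray (fun j : 'I_k.+1 => e j) (widen_ord (leqnSn k) j)).
  rewrite /ray /=; case: (e j); rewrite /plus /minus /proj.
    by rewrite row_mxEr mxE.
  by rewrite row_mxEl mxE.
have projX (z : 'rV[R[i]]_(k.+1 + k.+1)) : Xhat (toric_limit w k.+1) z ->
    Xhat (toric_limit w k) (proj z).
  move=> /XE h; apply/XE => j.
  have := h (widen_ord (leqnSn k) j).
  by rewrite -(projE z (fun=> false)) -(projE z (fun=> true)).
have ordS (P : 'I_k.+1 -> Prop) : P ord_max -> (forall j : 'I_k, P (widen_ord (leqnSn k) j)) ->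
    forall j : 'I_k.+1, P j.
  move=> Pm Pw j; have [jk|jk] := ltnP j k.
    by have := Pw (Ordinal jk); congr P; apply/val_inj.
  by suff -> : j = ord_max by []; apply/val_inj/eqP; rewrite /= eqn_leq jk -ltnS ltn_ord.
move=> z; rewrite /=; case: eqP => [ki|/eqP ki].
  have nI (j : 'I_k) : (j : nat) \in I = false.
    by apply/negP => /Ii; have := ltn_ord j; lia.
  split=> [[Xz h]|[Xz h]]; split=> //.
    apply: ordS => [/eqP/(_ ki)//|j _].
    by rewrite -(projE z (fun j => j \in I)); have [_ /(_ j)] := h; rewrite /ray nI.
  split; first exact: projX.
  move=> j; have := h (widen_ord (leqnSn k) j).
  rewrite -(projE z (fun j => j \in I)) /ray nI; apply.
  by have := ltn_ord j; rewrite /=; lia.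
have ik' : (i < k)%N by lia.
split=> [[[Xz zm] /(IH ik')[_ h]]|[Xz h]].
  split=> //; apply: ordS => [_|j ji]; first exact: zm.
  by rewrite -(projE z (fun j => j \in I)); apply: h.
split; first by split=> //; have := h ord_max; apply.
apply/(IH ik'); split; first exact: projX.
by move=> j ji; rewrite (projE z (fun j => j \in I)); apply: h.
Qed.

Lemma lineE (i : 'I_(size w)) : @line R G w (index_set w i) =
  fixed_line (R := R) (toric_limit w (size w)) i
    (fun j : 'I_(size w) => (j : nat) \in index_set w i).
Proof.
have Ii j : j \in index_set w i -> (i <= j)%N.
  by rewrite mem_index_set => /orP[/eqP->//|/and3P[/ltnW]].
have E := lift_lineE Ii (ltn_ord i).
by apply/seteqP; split=> z /E.
Qed.

End ToricLimitRelations.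

(** * The Mori cone *)

Lemma closed_halfspace (R : realType) m (a : 'cV[R]_m) :
  closed [set v : 'rV[R]_m | 0 <= (v *m a) ord0 ord0].
Proof.
have -> : [set v : 'rV[R]_m | 0 <= (v *m a) ord0 ord0] =
    (fun v : 'rV[R]_m => \sum_rho v ord0 rho * a rho ord0) @^-1` [set t : R | 0 <= t].
  by apply/seteqP; split=> v /=; rewrite mxE.
apply: preimage_closed; last exact: closed_ge.
move=> v _; move: v; elim: (index_enum _) => [|rho s IH] v.
  have -> : (fun v : 'rV[R]_m => \sum_(rho <- [::]) v ord0 rho * a rho ord0) = fun=> 0.
    by apply/funext => u; rewrite big_nil.
  exact: cst_continuous.
have -> : (fun v : 'rV[R]_m => \sum_(l <- rho :: s) v ord0 l * a l ord0) =
    fun v => v ord0 rho * a rho ord0 + \sum_(l <- s) v ord0 l * a l ord0.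
  by apply/funext => u; rewrite big_cons.
have h : (fun u : 'rV[R]_m => u ord0 rho * a rho ord0) @ v -->
    v ord0 rho * a rho ord0.
  exact: cvgMr_tmp (@coord_continuous R 1 m ord0 rho v).
exact: cvgD h (IH v).
Qed.

Section MoriCone.
Variables (R : realType) (r : nat) (F : fan r (r + r)).
Variable c : 'I_r -> 'I_(r + r) -> nat.
Hypothesis Fc : positive_fan F c.
Implicit Types (v x y : 'rV[R]_(r + r)) (i j : 'I_r).

Lemma mori_cone_ge0 (a : 'cV[R]_(r + r)) :
  (forall Z, irreducible_curve F Z -> 0 <= (curve_class F Z *m a) ord0 ord0) ->
  forall v, mori_cone F v -> 0 <= (v *m a) ord0 ord0.
Proof.
move=> ha v; rewrite /mori_cone => vK.
suff : closure [set v : 'rV[R]_(r + r) | 0 <= (v *m a) ord0 ord0] v.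
  by rewrite -(closure_id _).1 //; apply: closed_halfspace.
apply: closure_subset vK => _ [k [x [s [x0 sS ->]]]] /=.
rewrite mulmx_suml summxE; apply: sumr_ge0 => l _.
rewrite -scalemxAl mxE; apply: mulr_ge0 => //.
by have [Z Zc ->] := sS l; apply: ha.
Qed.

Local Notation relR := (map_mx intr (relmx c) : 'M[R]_(r + r, r)).

(** The rows are globally generated divisors dual to the primitive relations. *)
Lemma ex_dual_matrix : exists N : 'M[int]_(r, r + r), N *m relmx c = 1%:M.
Proof.
have /choice[D hD] j := ex_divisor Fc (basis_class_nonneg j).
exists (\matrix_j D j); apply/row_matrixP => j.
by rewrite row_mul rowK hD row1.
Qed.

(** The coordinates are the degrees of the dual divisors. Nonnegativity and membership in the span
    of the relations are closed conditions, so testing them on curves suffices. *)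
Lemma mori_cone_coord v : mori_cone F v ->
  exists m : 'rV[R]_r, (forall j, 0 <= m ord0 j) /\ v = m *m relR^T.
Proof.
have [N NM] := ex_dual_matrix.
pose NR : 'M[R]_(r, r + r) := map_mx intr N.
have NRM : relR^T *m NR^T = 1%:M by rewrite -trmx_mul -map_mxM NM map_mx1 trmx1.
have cone Z : irreducible_curve F Z -> exists m : 'rV[R]_r,
    (forall j, 0 <= m ord0 j) /\ curve_class F Z = m *m relR^T.
  move=> /(curve_class_in_cone Fc)[m [m0 ->]].
  exists (map_mx intr m^T); split=> [j|]; first by rewrite !mxE ler0z.
  by rewrite trmx_mul map_mxM map_trmx.
move=> vK; exists (v *m NR^T); split=> [j|].
  have -> : (v *m NR^T) ord0 j = (v *m col j NR^T) ord0 ord0.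
    by rewrite !mxE; apply: eq_bigr => l _; rewrite !mxE.
  apply: mori_cone_ge0 vK => Z /cone[m [m0 ->]].
  have -> : (m *m relR^T *m col j NR^T) ord0 ord0 = (m *m relR^T *m NR^T) ord0 j.
    by rewrite [LHS]mxE [RHS]mxE; apply: eq_bigr => l _; rewrite [col _ _ _ _]mxE.
  by rewrite -mulmxA NRM mulmx1.
(* [v *m P = 0] says that [v] is recovered from its coordinates; each entry is shown to be both
   nonnegative and nonpositive. *)
pose P : 'M[R]_(r + r) := NR^T *m relR^T - 1%:M.
have P0 Z : irreducible_curve F Z -> curve_class F Z *m P = 0.
  by move=> /cone[m [_ ->]]; rewrite mulmxBr mulmx1 mulmxA -[m *m _ *m _]mulmxA NRM mulmx1 subrr.
have vP (a : 'M[R]_(r + r)) rho : (v *m a) ord0 rho = (v *m col rho a) ord0 ord0.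
  by rewrite !mxE; apply: eq_bigr => l _; rewrite !mxE.
suff E : v *m P = 0.
  by apply/eqP; rewrite eq_sym -subr_eq0 -mulmxA -{2}[v]mulmx1 -mulmxBr E.
apply/rowP => rho; rewrite [RHS]mxE; apply/eqP; rewrite eq_le.
have colE a Z : irreducible_curve F Z -> curve_class F Z *m a = 0 ->
    0 <= (curve_class F Z *m col rho a) ord0 ord0.
  by move=> _ h; rewrite colE mulmxA h mul0mx mxE.
apply/andP; split; last first.
  by rewrite vP; apply: mori_cone_ge0 vK => Z Zc; apply: colE => //; apply: P0.
have -> : (v *m P) ord0 rho = - (v *m - P) ord0 rho by rewrite mulmxN [in RHS]mxE opprK.
rewrite oppr_le0 vP; apply: mori_cone_ge0 vK => Z Zc.
by apply: colE => //; rewrite mulmxN P0 ?oppr0.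
Qed.

Variables (i : 'I_r) (e : 'I_r -> bool).
Hypothesis rel_e : forall rho, c i rho != 0%N -> rho = ray e (position rho).
Local Notation L := (@fixed_line R r F i e).

(** In the coordinates of [mori_cone_coord] the class is a basis vector, and nonnegative coordinates
    with sum zero are zero. *)
Lemma fixed_line_extremal : extremal_ray (mori_cone F) (half_line (curve_class F L)).
Proof.
have [N NM] := ex_dual_matrix.
pose NR : 'M[R]_(r, r + r) := map_mx intr N.
have NRM : relR^T *m NR^T = 1%:M by rewrite -trmx_mul -map_mxM NM map_mx1 trmx1.
have LE : curve_class F L = delta_mx ord0 i *m relR^T.
  by rewrite (curve_class_fixed_line R Fc rel_e) -rowE; apply/rowP => rho; rewrite !mxE.
split.
- exists (curve_class F L) => //; rewrite LE; apply/eqP => /(congr1 (mulmx^~ NR^T)).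
  rewrite -mulmxA NRM mulmx1 mul0mx => /rowP/(_ i); rewrite !mxE !eqxx => /eqP.
  by rewrite oner_eq0.
- move=> _ [t t0 ->]; apply: subset_closure.
  exists 1%N, (fun=> t), (fun=> curve_class F L); split=> //; last by rewrite big_ord1.
  by move=> _; exists L => //; apply: fixed_line_curve rel_e.
- move=> x y /mori_cone_coord[a [a0 ->]] /mori_cone_coord[b [b0 ->]] [t t0].
  rewrite LE -mulmxDl scalemxAl => /(congr1 (mulmx^~ NR^T)).
  rewrite -!mulmxA NRM !mulmx1 => /rowP E.
  have z j : j != i -> a ord0 j = 0 /\ b ord0 j = 0.
    move=> /negPf ji; have /eqP := E j; rewrite !mxE ji andbF mulr0.
    by rewrite paddr_eq0 // => /andP[/eqP -> /eqP ->].
  have half (d : 'rV[R]_r) : (forall j, 0 <= d ord0 j) ->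
      (forall j, j != i -> d ord0 j = 0) ->
      half_line (delta_mx ord0 i *m relR^T) (d *m relR^T).
    move=> d0 dz; exists (d ord0 i) => //; rewrite scalemxAl; congr (_ *m _).
    apply/rowP => j; rewrite !mxE eqxx /=.
    by have [->|/dz ->] := eqVneq j i; rewrite ?mulr1 ?mulr0.
  by split; apply: half => // j /z[].
Qed.

Lemma canonical_dot_fixed_line : dot1 (canonical_divisor (r + r)) (curve_class F L) =
  (\sum_rho c i rho)%:R - 2.
Proof.
rewrite (curve_class_fixed_line R Fc rel_e) /dot1.
have term rho : (canonical_divisor (r + r) ord0 rho)%:~R *
    (map_mx intr (col i (relmx c))^T : 'rV[R]_(r + r)) ord0 rho =
    (c i rho)%:R - (position rho == i)%:R.
  by rewrite /canonical_divisor !mxE rmorphN1 mulN1r rmorphB /= opprB; case: eqP.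
rewrite (eq_bigr _ (fun rho _ => term rho)) sumrB natr_sum; congr (_ - _).
rewrite (sum_rays e) (bigD1 i) //= big1 ?addr0 => [|j /negPf ji].
  by rewrite !position_ray eqxx.
by rewrite !position_ray ji addr0.
Qed.

Lemma fixed_line_mori_ray : mori_ray F (half_line (curve_class F L)) <->
  (\sum_rho c i rho < 2)%N.
Proof.
have dotZ t : dot1 (canonical_divisor (r + r)) (t *: curve_class F L) =
    t * ((\sum_rho c i rho)%:R - 2).
  rewrite -canonical_dot_fixed_line /dot1 mulr_sumr; apply: eq_bigr => rho _.
  by rewrite [X in _ * X = _]mxE mulrCA.
have [[v v0 vE] _ _] := fixed_line_extremal.
have L0 : curve_class F L != 0.
  apply/eqP => L0; have : half_line (curve_class F L) v.
    by rewrite vE; exists 1; rewrite ?ler01 ?scale1r.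
  by move=> [t _]; rewrite L0 scaler0 => E; rewrite E eqxx in v0.
split=> [[_ h]|lt2].
  have := h (curve_class F L); rewrite canonical_dot_fixed_line.
  rewrite subr_lt0 ltr_nat; apply=> //.
  by exists 1; rewrite ?ler01 ?scale1r.
split; first exact: fixed_line_extremal.
move=> _ [t t0 ->] tL; rewrite dotZ pmulr_rlt0 ?subr_lt0 ?ltr_nat //.
by rewrite lt_neqAle t0 andbT eq_sym; apply: contraNneq tL => ->; rewrite scale0r.
Qed.

End MoriCone.

(** * Uniqueness of the primitive relation and the degree criterion *)

Section PrimitiveRelation.
Variables (R : realType) (G : kac_moody) (w : seq (simple G)).
Local Notation c := (@primitive_coefficient G w (size w)).

(** The difference [d] of the two expansions is killed position by position, starting from the
    first. This identifies the given real coefficients with the computed integers. *)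
Lemma primitive_relation_unique (i : 'I_(size w)) gamma (c' : 'I_(size w + size w) -> R) :
  primitive_relation i gamma c' ->
  forall rho, (c i rho)%:R = if rho \in gamma then c' rho else 0.
Proof.
move=> [gcone c'0 /rowP rel] rho; apply/eqP; rewrite eq_sym -subr_eq0; apply/eqP.
pose u rho l : R := (rays (toric_limit w (size w)) rho l)%:~R.
pose c1 rho : R := if rho \in gamma then c' rho else 0.
pose d rho : R := c1 rho - (c i rho)%:R.
have uE h l : (map_mx intr (row h (rays (toric_limit w (size w)))) :
    'rV[R]_(size w)) 0 l = u h l.
  by rewrite mxE; congr (_%:~R); rewrite mxE.
have sum0 l : \sum_rho d rho * u rho l = 0.
  rewrite /d; under eq_bigr do rewrite mulrBl.
  rewrite sumrB; apply/eqP; rewrite subr_eq0; apply/eqP.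
  transitivity (u (plus i) l + u (minus i) l).
    rewrite -!uE; have := rel l; rewrite [LHS]mxE => ->; rewrite summxE [RHS]big_mkcond.
    apply: eq_bigr => h _; rewrite /c1; case: ifP => _; last by rewrite mul0r.
    by rewrite [RHS]mxE uE.
  rewrite /u -intrD -primitive_relation_rays rmorph_sum /=.
  by apply: eq_bigr => h _; rewrite intrM.
suff h n : forall rho, (position rho < n)%N -> d rho = 0.
  exact: (h (position rho).+1).
elim: n => // n IH {}rho; rewrite ltnS leq_eqVlt => /orP[/eqP rn|/IH//].
set l := position rho in rn.
(* Coordinate [l] of the relation: smaller positions vanish by induction and rays of greater
   positions have no such coordinate. *)
have E : d (plus l) = d (minus l).
  have := sum0 l; rewrite (sum_rays (fun=> false)) (bigD1 l) //= big1 => [|h hl].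
    rewrite /ray /= /u rays_plus rays_minus eqxx ltnn mul0r subr0 mulr1 mulrN1 addr0.
    by move/eqP; rewrite subr_eq0 => /eqP.
  rewrite /ray /=; have [hln|lh] := ltnP h l.
    by rewrite !IH ?mul0r ?addr0 // ?position_plus ?position_minus -rn.
  have lh' : (l < h)%N by rewrite ltn_neqAle lh andbT eq_sym.
  rewrite /u rays_plus rays_minus (negPf hl) ltnNge (ltnW lh') /=.
  by rewrite mul0r subr0 oppr0 !mulr0 addr0.
have c1ge h : 0 <= c1 h by rewrite /c1; case: ifP => // /c'0/ltW.
have c1z : c1 (plus l) = 0 \/ c1 (minus l) = 0.
  move: gcone; rewrite inE => /forallP/(_ l); rewrite negb_and /c1.
  by case/orP => /negPf ->; [left|right].
have cz : (c i (plus l))%:R = 0 :> R \/ (c i (minus l))%:R = 0 :> R.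
  by case: (relation_cone (toric_limit_positive_fan w (size w)) i l) => ->; [left|right].
have cge h : 0 <= (c i h)%:R :> R by [].
(* Each expansion is nonnegative and zero on one of the two opposite rays, so the equal differences
   vanish. *)
have := c1ge (plus l); have := c1ge (minus l); have := cge (plus l); have := cge (minus l).
move: E; rewrite /d; case: (plus_or_minus rho) => ->; rewrite -/l.
  by case: c1z => ->; case: cz => ->; lra.
by case: c1z => ->; case: cz => ->; lra.
Qed.

(** The coefficients on [gamma] are positive integers, so a sum below 2 leaves no ray, or one ray
    with coefficient 1. *)
Lemma primitive_relation_lt2 (i : 'I_(size w)) gamma (c' : 'I_(size w + size w) -> R) :
  primitive_relation i gamma c' ->
  (\sum_rho c i rho < 2)%N <->
  (#|gamma| = 0%N \/ (#|gamma| = 1%N /\ forall rho, rho \in gamma -> c' rho = 1)).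
Proof.
move=> rel; have cE := primitive_relation_unique rel.
have [_ c'0 _] := rel.
have sumE : (\sum_rho c i rho = \sum_(rho in gamma) c i rho)%N.
  rewrite [RHS]big_mkcond; apply: eq_bigr => rho _; case: ifPn => // /negPf ng.
  by have /eqP := cE rho; rewrite ng pnatr_eq0 => /eqP.
have c1 rho : rho \in gamma -> (0 < c i rho)%N.
  by move=> g; have := c'0 _ g; rewrite -(ltr_nat R) cE g.
have ge : (#|gamma| <= \sum_rho c i rho)%N.
  by rewrite sumE -sum1_card; apply: leq_sum => rho /c1.
split=> [lt2|[/eqP|[/eqP/cards1P[rho g] h]]].
- have : (#|gamma| < 2)%N by apply: leq_ltn_trans lt2.
  case E : #|gamma| => [|[|//]] _; [by left|right; split=> // rho g].
  have := cE rho; rewrite g => <-.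
  have : (c i rho <= \sum_rho c i rho)%N by rewrite (bigD1 rho) //= leq_addr.
  by have := c1 _ g; case: (c i rho) => [|[|k]] //; lia.
- by rewrite cards_eq0 sumE => /eqP ->; rewrite big_set0.
- rewrite sumE g big_set1; have /eqP := cE rho.
  by rewrite g set11 h ?g ?set11 // pnatr_eq1 => /eqP ->.
Qed.

End PrimitiveRelation.

Theorem corollary7p10 (R : realType) (G : kac_moody) (w : seq (simple G))
    (i : 'I_(size w)) (gamma : {set 'I_(size w + size w)})
    (c : 'I_(size w + size w) -> R) :
  primitive_relation i gamma c ->
  mori_ray (toric_limit w (size w))
    (half_line (curve_class (toric_limit w (size w))
                  (line R w (index_set w i))))
  <-> (#|gamma| = 0%N \/
       (#|gamma| = 1%N /\ forall rho, rho \in gamma -> c rho = 1)).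
Proof.
move=> rel; rewrite lineE -(primitive_relation_lt2 rel).
apply: (fixed_line_mori_ray R (toric_limit_positive_fan w (size w))).
exact: index_set_ray.
Qed.
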